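(* Let $k\ge 2$, let $\sigma=\sigma_0\sigma_1\cdots\sigma_{k-1}\in\{+,-\}^k$, and let $\pi$ be a permutation in $\mathcal{S}_n$. Then $\pi\in\operatorname{Allow}(\Sigma_\sigma)$ if and only if there exists a valid $\sigma$-segmentation of $\hat{\pi}^{\star}$.
   Context: **Signed shift.** Let $T_\sigma^{+}=\{t:\sigma_t=+\}$ and $T_\sigma^-=\{t:\sigma_t=-\}$. Let $\mathcal{W}_k$ be the set of infinite words $w=w_1w_2\cdots$ on the alphabet $\{0,1,\dots,k-1\}$. The linear order $<_\sigma$ on $\mathcal{W}_k$ is defined as follows: for $v\neq w$ let $j$ be the first position where they differ; if the number of $i<j$ with $v_i\in T_\sigma^-$ is even, then $v<_\sigma w$ iff $v_j<w_j$; if that number is odd, then $v<_\sigma w$ iff $v_j>w_j$. The signed shift $\Sigma_\sigma:\mathcal{W}_k\to\mathcal{W}_k$ is $\Sigma_\sigma(w_1w_2w_3\cdots)=w_2w_3\cdots$, where $\mathcal W_k$ is ordered by $<_\sigma$. **Patterns.** For a map $f:X\to X$ on a linearly ordered set and $x\in X$ such that $x,f(x),\dots,f^{n-1}(x)$ are distinct, $\operatorname{Pat}(x,f,n)\in\mathcal{S}_n$ is the permutation whose entries are in the same relative order as $x,f(x),\dots,f^{n-1}(x)$ (smallest value replaced by $1$, and so on); it is undefined if the values are not distinct. $\operatorname{Allow}_n(f)=\{\operatorname{Pat}(x,f,n):x\in X\}$ and $\operatorname{Allow}(f)=\bigcup_{n\ge1}\operatorname{Allow}_n(f)$. **Marked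 cycle.** For $\pi=\pi_1\cdots\pi_n\in\mathcal{S}_n$, the sequence $\hat\pi^\star=\hat\pi^\star_1\cdots\hat\pi^\star_n$ is defined by $\hat\pi^\star_{\pi_i}=\pi_{i+1}$ for $1\le i\le n-1$ and $\hat\pi^\star_{\pi_n}=\star$ (a symbol). A block of consecutive entries of $\hat\pi^\star$ is called increasing (decreasing) if it is so after deleting $\star$, if present. **$\sigma$-segmentation.** A $\sigma$-segmentation of $\hat\pi^\star$ is a sequence $E=(e_0,e_1,\dots,e_k)$ of integers with $0=e_0\le e_1\le\dots\le e_k=n$ such that (a) for all $0\le t\le k-1$, $\hat\pi^\star_{e_t+1}\hat\pi^\star_{e_t+2}\cdots\hat\pi^\star_{e_{t+1}}$ is increasing if $\sigma_t=+$ and decreasing if $\sigma_t=-$; (b) if $\sigma_0=+$ and $\pi_{n-1}\pi_n=21$, then $e_1=0$; (c) if $\sigma_{k-1}=+$ and $\pi_{n-1}\pi_n=(n-1)n$, then $e_{k-1}=n-1$; (d) if $\sigma_0=\sigma_{k-1}=-$ and $\pi_{n-2}\pi_{n-1}\pi_n=(n-1)\,1\,n$, then $e_1=0$ or $e_{k-1}=n-1$; (e) if $\sigma_0=\sigma_{k-1}=-$ and $\pi_{n-2}\pi_{n-1}\pi_n=2\,n\,1$, then $e_1=0$ or $e_{k-1}=n$; (f) $e_t\ne\pi_n$ for all $1\le t\le k-1$. Its associated word (prefix) is $\zeta=z_1z_2\cdots z_{n-1}$, with $z_i=j$ whenever $e_j<\pi_i\le e_{j+1}$. Write $z_{[i,j]}=z_iz_{i+1}\cdots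 z_j$. **Validity.** If $\pi_n\ne n$, let $x$ be the index with $\pi_x=\pi_n+1$ and $p=z_{[x,n-1]}$. If $\pi_n\neq1$, let $y$ be the index with $\pi_y=\pi_n-1$ and $q=z_{[y,n-1]}$. The $\sigma$-segmentation is invalid if $\pi_n\notin\{1,n\}$ and ($p=q^2$ or $q=p^2$), where $d^2$ is the concatenation of $d$ with itself; otherwise it is valid. *)

(* Defs.v *)
From HB Require Import structures.
From mathcomp Require Import all_boot all_order all_fingroup.
From mathcomp Require Import boolp classical_sets.

Set Implicit Arguments.
Unset Strict Implicit.
Unset Printing Implicit Defensive.

Inductive sign := Plus | Minus.

(* Positions of a word are numbered from 0: w_1, w_2, ... is w 0, w 1, ...
   The signature is a phantom parameter: it only selects the order on words. *)
Definition word k (sigma : k.-tuple sign) : Type := nat -> 'I_k.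

HB.instance Definition _ k (sigma : k.-tuple sign) :=
  Choice.copy (word sigma) (nat -> 'I_k).

Definition T_minus k (sigma : k.-tuple sign) : pred 'I_k :=
  fun t => if tnth sigma t is Minus then true else false.

Definition word_lt k (sigma : k.-tuple sign) (v w : word sigma) : Prop :=
  exists j : nat,
    [/\ forall i, i < j -> v i = w i, v j <> w j &
        if odd #|[pred i : 'I_j | T_minus sigma (v i)]|
        then v j > w j else v j < w j].

Section WordOrder.
Variables (k : nat) (sigma : k.-tuple sign).
Implicit Types u v w : word sigma.

Let lt : rel (word sigma) := fun v w => `[< word_lt v w >].

Let eq_card_minus v w j : (forall i, i < j -> v i = w i) ->
  #|[pred i : 'I_j | T_minus sigma (v i)]| =
  #|[pred i : 'I_j | T_minus sigma (w i)]|.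
Proof. by move=> e; apply: eq_card => i; rewrite !inE e. Qed.

Fact word_lt_irr : irreflexive lt.
Proof. by move=> v; apply/asboolP => -[j [_ /(_ erefl)]]. Qed.

Fact word_lt_trans : transitive lt.
Proof.
move=> v u w /asboolP[i [uv nuv lt_uv]] /asboolP[j [vw nvw lt_vw]].
apply/asboolP; case: (ltngtP i j) => ij.
- exists i; split; last 2 first.
  + by rewrite -vw.
  + by rewrite -vw.
  by move=> m mi; rewrite uv // vw // (ltn_trans mi).
- exists j; split; last 2 first.
  + by rewrite uv.
  + rewrite (@eq_card_minus u v) ?uv // => m mj.
    by rewrite uv // (ltn_trans mj).
  by move=> m mj; rewrite uv ?vw // (ltn_trans mj).
subst j; exists i.
have uw m : m < i -> u m = w m by move=> mi; rewrite uv ?vw.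
rewrite -(eq_card_minus uv) in lt_vw.
have lt_uw : if odd #|[pred m : 'I_i | T_minus sigma (u m)]|
             then u i > w i else u i < w i.
  by case: ifP lt_uv lt_vw => _; [move=> a b; exact: ltn_trans b a|exact: ltn_trans].
by split=> // e; move: lt_uw; rewrite e ltnn; case: ifP.
Qed.

Fact word_lt_total v w : v != w -> lt v w || lt w v.
Proof.
move=> nvw.
have [m nm] : exists m, v m != w m.
  apply: contrapT => /forallNP h; move/eqP: nvw; apply.
  by apply/funext => m; apply/eqP; apply: contrapT => /negP /h.
case: (@ex_minnP (fun m => v m != w m) (ex_intro _ m nm)) => j nj jmin.
have e i : i < j -> v i = w i.
  by move=> ij; apply/eqP; apply: contraTT ij => /jmin; rewrite -leqNgt.
have := nj; rewrite -val_eqE neq_ltn => lt_j.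
have le_vw := eq_card_minus e.
apply/orP; case b: (odd #|[pred i : 'I_j | T_minus sigma (v i)]|);
  case/orP: lt_j => lt_j.
- right; apply/asboolP; exists j; split=> [i ij||]; first by rewrite e.
    by move=> ewv; rewrite ewv eqxx in nj.
  by rewrite -le_vw b.
- by left; apply/asboolP; exists j; split=> //; [exact/eqP|rewrite b].
- by left; apply/asboolP; exists j; split=> //; [exact/eqP|rewrite b].
- right; apply/asboolP; exists j; split=> [i ij||]; first by rewrite e.
    by move=> ewv; rewrite ewv eqxx in nj.
  by rewrite -le_vw b.
Qed.

HB.instance Definition _ := @Order.LtOrder.Build (Order.Disp tt tt)
  (word sigma) (fun v w => (v == w) || lt v w) lt
  (fun v w => if lt v w then v else w) (fun v w => if lt v w then w else v)
  (fun _ _ => erefl) (fun _ _ => erefl) (fun _ _ => erefl)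
  word_lt_irr word_lt_trans word_lt_total.

Fact word_ltP v w : reflect (word_lt v w) (v < w)%O.
Proof. exact: asboolP. Qed.

End WordOrder.

Definition signed_shift k (sigma : k.-tuple sign) (w : word sigma) :
  word sigma := fun i => w i.+1.

(* A permutation of {1, ..., n} is represented by pi : 'S_n with indices and
   values shifted down by one. Pat x f n is None when x, f x, ... are not
   distinct. *)
Definition Pat d (X : orderType d) (x : X) (f : X -> X) (n : nat) :
  option 'S_n :=
  if injectiveb (fun i : 'I_n => iter i f x) then
    [pick pi : 'S_n | [forall i : 'I_n, forall j : 'I_n,
       (pi i < pi j) == (iter i f x < iter j f x)%O]]
  else None.

Definition Allow_n d (X : orderType d) (f : X -> X) (n : nat) : set 'S_n :=
  [set pi | exists x : X, Pat x f n = Some pi]%classic.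

Definition Allow d (X : orderType d) (f : X -> X) : set {n : nat & 'S_n} :=
  [set p | 0 < tag p /\ @Allow_n d X f (tag p) (tagged p)]%classic.

Section PatFacts.
Variables (d : Order.disp_t) (X : orderType d) (f : X -> X) (n : nat).

Lemma PatP (x : X) (pi : 'S_n) :
  Pat x f n = Some pi <->
  injective (fun i : 'I_n => iter i f x) /\
  forall i j : 'I_n, (pi i < pi j) = (iter i f x < iter j f x)%O.
Proof.
rewrite /Pat; case: injectiveP => [inj|ninj]; last by split=> // -[].
have uniq_pat (s t : 'S_n) : (forall i j, (s i < s j) = (t i < t j)) -> s = t.
  move=> st; apply/permP => i; apply: val_inj.
  have rank (u : 'S_n) : u i = #|[pred j | u j < u i]| :> nat.
    rewrite -sum1_card; transitivity (\sum_(j : 'I_n | j < u i) 1).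
      by rewrite (big_ord_narrow (ltnW (ltn_ord (u i)))) sum1_card card_ord.
    by rewrite (reindex_inj (@perm_inj _ u)).
  by rewrite /= (rank s) (rank t); apply: eq_card => j; rewrite !inE st.
split=> [|[_ pat]]; case: pickP => [s /forallP pat_s|no_pat] //.
- by case=> <-; split=> // i j; have /forallP/(_ j)/eqP := pat_s i.
- congr Some; apply: uniq_pat => i j.
  by rewrite pat; have /forallP/(_ j)/eqP := pat_s i.
- have /negP[] := negbT (no_pat pi).
  by apply/forallP => i; apply/forallP => j; rewrite pat.
Qed.

Lemma Pat_defined (x : X) :
  injective (fun i : 'I_n => iter i f x) -> exists pi, Pat x f n = Some pi.
Proof.
move=> inj; pose A (i : 'I_n) := [pred j : 'I_n |
   (iter j f x < iter i f x)%O].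
have mono i j : (#|A i| < #|A j|) = (iter i f x < iter j f x)%O.
  case: Order.TotalTheory.leP => [le_ji|lt_ij].
    apply/negbTE; rewrite -leqNgt; apply: subset_leq_card.
    apply/fintype.subsetP => m.
    by rewrite !inE => /Order.POrderTheory.lt_le_trans; apply.
  apply/proper_card/properP; split.
    apply/fintype.subsetP => m; rewrite !inE => /Order.POrderTheory.lt_trans.
    exact.
  by exists i; rewrite !inE ?lt_ij // Order.POrderTheory.ltxx.
have lt_n i : #|A i| < n.
  rewrite -[n in _ < n]card_ord; apply/proper_card/properP.
  split; first exact/subset_predT.
  by exists i; rewrite !inE // Order.POrderTheory.ltxx.
have rank_inj : injective (fun i => Ordinal (lt_n i)).
  move=> i j [eq_ij]; apply: inj.
  by case: Order.TotalTheory.ltgtP (mono i j) (mono j i) => // _;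
    rewrite eq_ij ltnn.
exists (perm rank_inj); apply/PatP; split=> // i j.
by rewrite !permE mono.
Qed.

End PatFacts.

Section Segmentation.
Variables (k n : nat) (sigma : k.-tuple sign) (pi : 'S_n).

(* [:: pi_1; ...; pi_n], with values in {1, ..., n}. *)
Definition one_line : seq nat := [seq (pi i).+1 | i <- enum 'I_n].

Definition last_entry : nat := last 0 one_line.

(* None is the symbol star. *)
Definition marked_cycle : seq (option nat) :=
  [seq let i := index v one_line in
       if i.+1 < n then Some (nth 0 one_line i.+1) else None
  | v <- iota 1 n].

(* The entries in positions a + 1, ..., b of the marked cycle, star deleted. *)
Definition block (a b : nat) : seq nat :=
  pmap id (drop a (take b marked_cycle)).

Definition monotone_block (s : sign) (a b : nat) : bool :=
  match s with
  | Plus => sorted ltn (block a b)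
  | Minus => sorted gtn (block a b)
  end.

Definition sigma_ (t : nat) : sign := nth Plus sigma t.

Definition is_segmentation (E : k.+1.-tuple nat) : Prop :=
  let e := nth 0 E in
  [/\ e 0 = 0, e k = n & sorted leq E] /\
  [/\ forall t, t < k -> monotone_block (sigma_ t) (e t) (e t.+1),
      sigma_ 0 = Plus -> suffix [:: 2; 1] one_line -> e 1 = 0,
      sigma_ k.-1 = Plus -> suffix [:: n.-1; n] one_line -> e k.-1 = n.-1,
      sigma_ 0 = Minus -> sigma_ k.-1 = Minus ->
        suffix [:: n.-1; 1; n] one_line -> e 1 = 0 \/ e k.-1 = n.-1 &
      sigma_ 0 = Minus -> sigma_ k.-1 = Minus ->
        suffix [:: 2; n; 1] one_line -> e 1 = 0 \/ e k.-1 = n] /\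
  (forall t, 1 <= t <= k.-1 -> e t <> last_entry).

(* The letter j such that e_j < v <= e_(j+1). *)
Definition letter (E : k.+1.-tuple nat) (v : nat) : nat :=
  find (fun j => nth 0 E j < v <= nth 0 E j.+1) (iota 0 k).

Definition prefix_word (E : k.+1.-tuple nat) : seq nat :=
  [seq letter E v | v <- take n.-1 one_line].

(* z_[x, n-1], where x is the index with pi_x = v. *)
Definition subword_from (E : k.+1.-tuple nat) (v : nat) : seq nat :=
  drop (index v one_line) (prefix_word E).

Definition invalid (E : k.+1.-tuple nat) : Prop :=
  let p := subword_from E last_entry.+1 in
  let q := subword_from E last_entry.-1 in
  [/\ last_entry <> 1, last_entry <> n & p = q ++ q \/ q = p ++ p].

Definition valid_segmentation (E : k.+1.-tuple nat) : Prop :=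
  is_segmentation E /\ ~ invalid E.

End Segmentation.

(* Main.v *)
Require Import Defs.
From mathcomp Require Import all_boot all_order all_fingroup.
From mathcomp Require Import boolp classical_sets.
From mathcomp Require Import zify.

(** Let [pi] have length [n], put [N = n - 1] and number positions from 0. A word
    with pattern [pi] is a prefix [zeta] of [N] letters followed by a tail [s];
    its iterated shifts are the words [v_i], the suffix of [zeta] from position
    [i] followed by [s], and [v_N = s].

    From a word to a segmentation. If [v_i] and [v_j] start with the same letter,
    their order is that of [v_(i+1)] and [v_(j+1)], reversed when the letter is
    negative. So cutting the entries according to the first letters gives
    monotone blocks. The other conditions come from one fact, [lt_per]:
    [s < A s] if and only if [s < A A A ...], and likewise with the order
    reversed. With [p] and [q] the suffixes of [zeta] that start at the positions
    of the entries next above and next below the last one, it gives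
    [q q q ... < s < p p p ...], which fails when one of [p], [q] is the square
    of the other. Applied to suffixes of one or two letters, it shows in the same
    way that the configurations restricted by (b) to (e) would put [s] beyond the
    least or the greatest word.

    From a segmentation to a word. The segmentation determines [zeta] and makes it
    compatible with [pi]; only [s] has to be found. Comparing [v_i] with [v_j]
    letter by letter comes down to comparing [s] with some [v_l], and
    [orbit_iso] shows that the right comparisons with the two neighbours of the
    last entry suffice. By [lt_per] the conditions on [s] become
    [q q q ... < s < p p p ...]. This interval is non-empty because validity
    gives [q q q ... < p p p ...] ([per_gap]), and then [s = p p q q q ...] lies
    strictly inside ([between_per]). When the last entry is the least or the
    greatest, only one bound remains, and there is a word beyond it unless
    it is itself an extreme word; [extreme_neighbour] determines when that
    happens, and these are the cases that (b) to (e) exclude. *)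

Set Implicit Arguments.
Unset Strict Implicit.
Unset Printing Implicit Defensive.

Import Order.TTheory.

(** * Words, prefixes and periodic words *)

Section Words.
Variables (k : nat) (sigma : k.-tuple sign).
Implicit Types (c d : 'I_k) (A B : seq 'I_k) (u v w s : word sigma).

Local Notation shift := (@signed_shift k sigma).
Local Notation T := (T_minus sigma).

Definition consw c v : word sigma := fun i => if i is j.+1 then v j else c.

Definition catw A v : word sigma := foldr consw v A.

Definition parity A : bool := odd (count T A).

Definition agree m v w : Prop := forall i, i < m -> v i = w i.

Lemma consw_eta v : consw (v 0) (shift v) = v.
Proof. by apply/funext => -[]. Qed.

(** The parity count in the definition of the order is a sum over the common
    prefix; peeling off its first letter gives the recursion on which every
    comparison below is based. *)
Lemma word_lt_rec v w : (v < w)%O =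
  (v 0 < w 0) || (v 0 == w 0) &&
    (if T (v 0) then (shift w < shift v)%O else (shift v < shift w)%O).
Proof.
have card_rec (x : word sigma) j : #|[pred i : 'I_j.+1 | T (x i)]| =
    T (x 0) + #|[pred i : 'I_j | T (shift x i)]|.
  rewrite -!sum1_card big_mkcond big_ord_recl [in RHS]big_mkcond /=.
  by congr (_ + _); rewrite inE; case: (T _).
have sound (v' w' : word sigma) : (v' < w')%O ->
    (v' 0 < w' 0) || (v' 0 == w' 0) &&
    (if T (v' 0) then (shift w' < shift v')%O else (shift v' < shift w')%O).
  move/word_ltP => [[|j] [e nvw lt_vw]].
    by move: lt_vw; rewrite eq_card0 => [/= -> //|[]].
  rewrite (e 0) // eqxx ltnn /= -(e 0) //.
  move: lt_vw; rewrite card_rec oddD; case: (T (v' 0)) => /= lt_vw.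
    apply/word_ltP; exists j; split => [i ij|ewv|].
    - by rewrite /signed_shift e.
    - by apply: nvw; rewrite -[w' j.+1]/(shift w' j) ewv.
    - have -> : #|[pred i : 'I_j | T (shift w' i)]| =
                #|[pred i : 'I_j | T (shift v' i)]|.
        by apply: eq_card => i; rewrite !inE /signed_shift e // ltnS ltn_ord.
      by move: lt_vw; rewrite /signed_shift; case: (odd _).
  by apply/word_ltP; exists j; split => // i ij; rewrite /signed_shift e.
apply/idP/idP => [/sound //|]; apply: contraLR; rewrite -!leNgt le_eqVlt.
case/predU1P => [->|/sound]; first by rewrite ltnn eqxx /=; case: ifP; rewrite ltxx.
case: (ltngtP (v 0) (w 0)) => [lt_vw|lt_wv|e] //=.
- by rewrite -val_eqE /= gtn_eqF ?andbF // => /andP[].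
- by rewrite -val_eqE /= gtn_eqF.
by rewrite (val_inj e) eqxx; case: ifP => _ /lt_gtF ->.
Qed.

Lemma lt_consw c v w :
  (consw c v < consw c w)%O = if T c then (w < v)%O else (v < w)%O.
Proof. by rewrite word_lt_rec /= ltnn eqxx. Qed.

Lemma lt_catw A v w :
  (catw A v < catw A w)%O = if parity A then (w < v)%O else (v < w)%O.
Proof.
elim: A v w => [//|c A IH] v w; rewrite lt_consw !IH /parity /= oddD.
by case: (T c); case: (odd _).
Qed.

Lemma catw_cat A B v : catw (A ++ B) v = catw A (catw B v).
Proof. exact: foldr_cat. Qed.

Lemma consw_inj c d v w : consw c v = consw d w -> c = d /\ v = w.
Proof.
move=> e; split; first exact: (congr1 (fun x : word sigma => x 0) e).
exact: (congr1 shift e).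
Qed.

Lemma catw_inj A v w : catw A v = catw A w -> v = w.
Proof. by elim: A => [//|c A IH] /= /consw_inj [_ /IH]. Qed.

Lemma catw_prefix A B v w : size A <= size B -> catw A v = catw B w ->
  B = A ++ drop (size A) B.
Proof.
elim: A B => [|c A IH] [|d B] //=.
by rewrite ltnS => /IH eqB /consw_inj [-> /eqB {1}->].
Qed.

Lemma iter_shift i w j : iter i shift w j = w (i + j).
Proof. by elim: i j => [//|i IH] j; rewrite iterS /signed_shift IH addnS. Qed.

Lemma iter_shift_catw A v : iter (size A) shift (catw A v) = v.
Proof. by elim: A => [//|c A IH] /=; rewrite -iterS iterSr. Qed.

Lemma catwE c B v i :
  catw B v i = if i < size B then nth c B i else v (i - size B).
Proof. by elim: B i => [|b B IH] [|i] //=; rewrite IH. Qed.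

Lemma catw_take i v : catw (mkseq v i) (iter i shift v) = v.
Proof.
apply/funext => j; rewrite (catwE (v 0)) size_mkseq iter_shift.
by case: ltnP => ij; rewrite ?nth_mkseq // subnKC.
Qed.

Lemma agreeS m v w : agree m.+1 v w <-> v 0 = w 0 /\ agree m (shift v) (shift w).
Proof.
split=> [e|[e0 e] [|i] //]; last exact: e.
by split=> [|i im]; apply: e.
Qed.

Lemma agree_sym m v w : agree m v w -> agree m w v.
Proof. by move=> e i /e ->. Qed.

Lemma agree_eq v w : (forall m, agree m v w) -> v = w.
Proof. by move=> e; apply/funext => i; apply: (e i.+1). Qed.

(** Words with a given prefix form an interval, so a limit can be pinned down by
    sandwiching. *)
Lemma agree_between m u v w :
  (u <= v)%O -> (v <= w)%O -> agree m u w -> agree m u v.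
Proof.
elim: m u v w => [//|m IH] u v w leuv levw /agreeS [e0 e].
have e1 : u 0 = v 0.
  apply: val_inj; apply/eqP; rewrite eqn_leq; apply/andP; split.
    by move: leuv; rewrite leNgt word_lt_rec negb_or -leqNgt => /andP[].
  by rewrite e0; move: levw; rewrite leNgt word_lt_rec negb_or -leqNgt => /andP[].
apply/agreeS; split=> //.
move: leuv levw; rewrite 2!leNgt.
rewrite [(v < u)%O]word_lt_rec [(w < v)%O]word_lt_rec -e1 e0 !ltnn !eqxx /=.
case: ifP => _; rewrite -!leNgt => leuv levw; last exact: IH leuv levw e.
have := IH _ _ _ levw leuv (agree_sym e) => wv i im.
by rewrite e // wv.
Qed.

(** The comparison of [v] with [w] is settled at their first difference, hence
    depends only on the letters of [v] up to there. *)
Lemma lt_agree m v v' w : agree m v v' -> ~ agree m v w ->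
  (v < w)%O = (v' < w)%O /\ (w < v)%O = (w < v')%O.
Proof.
elim: m v v' w => [|m IH] v v' w; first by move=> _ [].
move=> /agreeS[e0 e] nvw; rewrite ![(_ < w)%O]word_lt_rec ![(w < _)%O]word_lt_rec -e0.
case: (eqVneq (v 0) (w 0)) => [ew|nw]; last by split; rewrite //= eq_sym (negbTE nw).
have [h|-> ->] := IH _ _ (shift w) e; first by apply: nvw; apply/agreeS.
by [].
Qed.

Lemma agree_catw A v w : agree (size A) (catw A v) (catw A w).
Proof. by elim: A => [//|c A IH]; apply/agreeS. Qed.

Lemma agree_catwD A m v w : agree m v w -> agree (size A + m) (catw A v) (catw A w).
Proof. by move=> e; elim: A => [//|c A IH]; apply/agreeS. Qed.

Lemma agree_trans m v w u : agree m v w -> agree m w u -> agree m v u.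
Proof. by move=> e e' i im; rewrite e ?e'. Qed.

(** The default letter [c] is reached only when [A] is empty. *)
Definition per c A : word sigma := fun i => nth c A (i %% size A).

Lemma per_catw c A : A != [::] -> catw A (per c A) = per c A.
Proof.
move=> A0; have sA : 0 < size A by rewrite lt0n size_eq0.
apply/funext => i; rewrite (catwE c) /per; case: ltnP => [iA|Ai].
  by rewrite modn_small.
by rewrite -{2}(subnK Ai) modnDr.
Qed.

Lemma per_unique c A v : A != [::] -> catw A v = v -> v = per c A.
Proof.
move=> A0 eA; apply: agree_eq; have sA : 0 < size A by rewrite lt0n size_eq0.
elim=> [//|m IH] i im; rewrite -eA -(per_catw c A0).
have := agree_catwD (A := A) IH; apply.
by apply: leq_trans im _; rewrite -add1n leq_add2r.
Qed.

(** Prepending [A] moves a word to the side on which the fixed point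
    [A A A ...] lies, whatever the parity of [A]. Indeed, as long as [s] starts
    with [A], removing it from both sides reverses both comparisons or neither;
    once [s] no longer starts with [A], both are settled within the first
    [size A] letters, where [catw A s] and the fixed point agree. *)
Lemma lt_per c A s : A != [::] ->
  (s < catw A s)%O = (s < per c A)%O /\ (catw A s < s)%O = (per c A < s)%O.
Proof.
move=> A0; case: (eqVneq s (per c A)) => [->|ns].
  by rewrite per_catw // ltxx.
have [m nm] : exists m, ~ agree m s (per c A).
  apply: contrapT => /forallNP h; move/eqP: ns; apply.
  by apply: agree_eq => m; apply: contrapT => /h.
elim: m s ns nm => [|m IH] s ns nm; first by case: nm.
case: (EM (agree (size A) s (per c A))) => [eA|nA]; last first.
  have := @lt_agree (size A) (catw A s) (per c A) s.
  case; first by rewrite -(per_catw c A0); apply: agree_catw.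
    move=> e; apply: nA; apply: agree_trans (agree_sym e) _.
    by rewrite -(per_catw c A0); apply: agree_catw.
  by move=> -> ->.
have es : s = catw A (iter (size A) shift s).
  rewrite -{1}(catw_take (size A) s); congr catw.
  apply: (@eq_from_nth _ c); rewrite size_mkseq // => i iA.
  by rewrite nth_mkseq // eA // /per modn_small.
set s' := iter _ _ _ in es.
have ns' : s' != per c A.
  by apply: contra_neq ns => e; rewrite es e per_catw.
have nm' : ~ agree m s' (per c A).
  move=> e; apply: nm; rewrite es -(per_catw c A0) => i im.
  have := agree_catwD (A := A) e; apply.
  by apply: leq_trans im _; rewrite -add1n leq_add2r lt0n size_eq0.
have [e1 e2] := IH s' ns' nm'.
rewrite es -(per_catw c A0) !lt_catw e1 e2.
by case: (parity A).
Qed.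

End Words.

(** * Extreme words *)

Section ExtremalWords.
Variables (k : nat) (sigma : k.+2.-tuple sign).
Implicit Types (b : bool) (v : word sigma).

Definition extreme_letter b : 'I_k.+2 := if b then ord_max else ord0.

(** A word that is extreme on side [b] starts with the extreme letter of that
    side; after that letter the rest must be extreme on side [flip_side b],
    because a negative letter reverses the order of what follows it. *)
Definition flip_side b : bool := b (+) T_minus sigma (extreme_letter b).

(** The least word for [b = false] and the greatest one for [b = true]. *)
Definition extreme_word b : word sigma :=
  fun i => extreme_letter (iter i flip_side b).

Lemma extreme_letter_inj : injective extreme_letter.
Proof. by move=> [] []. Qed.

Lemma extreme_word_rec b :
  extreme_word b = consw (extreme_letter b) (extreme_word (flip_side b)).
Proof.
by apply/funext => -[//|i] /=; rewrite /extreme_word iterSr.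
Qed.

(** A word beyond the extreme one would have to agree with it letter by
    letter. *)
Lemma extreme_word_bound b v :
  (if b then extreme_word b < v else v < extreme_word b)%O = false.
Proof.
suff agreeE m : forall b v,
    (if b then extreme_word b < v else v < extreme_word b)%O ->
    agree m v (extreme_word b).
  apply/negbTE/negP => lt_v; have e := agree_eq (fun m => agreeE m _ _ lt_v).
  by move: lt_v; rewrite e ltxx; case: (b).
elim: m => [//|m IH] {}b {}v lt_v.
have v0 : v 0 = extreme_letter b.
  move: lt_v; case: (b); rewrite word_lt_rec.
    case/orP => [|/andP[/eqP <-//]].
    by rewrite ltnNge leq_ord.
  by case/orP => [//|/andP[/eqP -> //]].
apply/agreeS; split=> //.
rewrite [X in agree _ _ (signed_shift X)]extreme_word_rec.
apply: (IH (flip_side b)).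
have ev : v = consw (extreme_letter b) (signed_shift v).
  by rewrite -v0 consw_eta.
move: (signed_shift v) ev lt_v => v' ->; rewrite extreme_word_rec !lt_consw.
by rewrite /flip_side; case: (b); case: (T_minus _ _).
Qed.

End ExtremalWords.

(** * Realizing an order by a tail *)

Section Realization.
Variables (k : nat) (sigma : k.-tuple sign) (c0 : 'I_k).
Variables (zeta : seq 'I_k) (P : nat -> nat).
Implicit Types (s : word sigma).

Local Notation N := (size zeta).
Local Notation z := (nth c0 zeta).
Local Notation T := (T_minus sigma).

(** [P i] plays the role of the entry of the permutation at position [i <= N] and
    [zeta] of the associated prefix, so that position [N] has no letter. The
    order of two entries must be the one that their first letters and the order
    of the next two entries dictate to the corresponding words. *)
Definition compatible : Prop := forall i j, i < N -> j < N -> P i < P j ->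
  z i <= z j /\ (z i = z j -> (P i.+1 < P j.+1) = ~~ T (z i)).

Definition orbit_word s i : word sigma := catw (drop i zeta) s.

Lemma orbit_word_rec s i : i < N ->
  orbit_word s i = consw (z i) (orbit_word s i.+1).
Proof. by move=> iN; rewrite /orbit_word (drop_nth c0 iN). Qed.

Lemma orbit_word_last s : orbit_word s N = s.
Proof. by rewrite /orbit_word drop_size. Qed.

Hypothesis P_inj : forall i j, i <= N -> j <= N -> P i = P j -> i = j.
Hypothesis P_compat : compatible.

Lemma P_ltn i j : i <= N -> j <= N -> i != j -> (P j < P i) = ~~ (P i < P j).
Proof.
move=> iN jN nij; case: (ltngtP (P i) (P j)) => // /(P_inj iN jN) e.
by rewrite e eqxx in nij.
Qed.

Lemma compatE i j : i < N -> j < N -> i != j -> z i = z j ->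
  (P i < P j) = T (z i) (+) (P i.+1 < P j.+1).
Proof.
move=> iN jN nij e; case: (ltnP (P i) (P j)) => [lt|].
  by have [_ ->] // := P_compat iN jN lt; rewrite addbN addbb.
move=> Pji; have lt : P j < P i.
  by rewrite (P_ltn (ltnW iN) (ltnW jN) nij) -leqNgt.
have [_ /(_ (esym e)) ji] := P_compat jN iN lt.
have nji : j.+1 != i.+1 by rewrite eqSS eq_sym.
by rewrite (P_ltn jN iN nji) ji e negbK addbb.
Qed.

(** Comparing two orbit words letter by letter runs into position [N], where the
    word is the tail [s]; the hypotheses then trade [s] for the orbit word of a
    position [x < N] whose entry does not pass the other one, so the comparison
    can go on. Reasoning by contradiction, a pair in the wrong order stays wrong after
    each such exchange, and by [agree_between] its common prefix does not get
    shorter; since every letter read is a common letter, the two words would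
    coincide. *)
Lemma orbit_monotone s :
  (forall j, j <= N -> P N < P j ->
     exists x, [/\ x < N, P x <= P j & (s <= orbit_word s x)%O]) ->
  (forall j, j <= N -> P j < P N ->
     exists y, [/\ y < N, P j <= P y & (orbit_word s y <= s)%O]) ->
  forall i j, i <= N -> j <= N -> P i < P j ->
    (orbit_word s i <= orbit_word s j)%O.
Proof.
move=> up dn.
suff agreeE m : forall i j, i <= N -> j <= N -> P i < P j ->
    (orbit_word s j < orbit_word s i)%O ->
    agree m (orbit_word s j) (orbit_word s i).
  move=> i j iN jN Pij; rewrite leNgt; apply/negP => lt_ji.
  have e := agree_eq (fun m => agreeE m i j iN jN Pij lt_ji).
  by rewrite e ltxx in lt_ji.
elim: m => [//|m IH].
have inner i j : i < N -> j < N -> P i < P j ->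
    (orbit_word s j < orbit_word s i)%O ->
    agree m.+1 (orbit_word s j) (orbit_word s i).
  move=> iN jN Pij lt_ji; have [le_ij Pij1] := P_compat iN jN Pij.
  have nij : i != j by apply: contraTneq Pij => ->; rewrite ltnn.
  have ez : z i = z j.
    apply: val_inj; apply/eqP; rewrite eqn_leq le_ij /=.
    move: lt_ji; rewrite (orbit_word_rec s iN) (orbit_word_rec s jN) word_lt_rec /=.
    by case/orP => [/ltnW//|/andP[/eqP ->]].
  move: lt_ji; rewrite (orbit_word_rec s iN) (orbit_word_rec s jN) -ez lt_consw => lt_ji.
  apply/agreeS; split=> //.
  move: lt_ji Pij1; case: ifP => Tz lt_ji /(_ ez) Pij1.
    apply/agree_sym/IH => //.
    by rewrite P_ltn ?Pij1 ?eqSS.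
  by apply/IH => //; rewrite Pij1.
move=> i j; rewrite leq_eqVlt => /predU1P[->|iN].
  move=> jN PNj; rewrite orbit_word_last => lt_js.
  have [x [xN Pxj le_sx]] := up _ jN PNj.
  have lt_jx : (orbit_word s j < orbit_word s x)%O by apply: lt_le_trans le_sx.
  have {}jN : j < N.
    by rewrite ltn_neqAle jN andbT; apply: contraTneq PNj => ->; rewrite ltnn.
  apply: agree_between (ltW lt_js) le_sx _; apply: inner => //.
  rewrite ltn_neqAle Pxj andbT; apply: contraTneq lt_jx => e.
  by rewrite (P_inj _ _ e) ?ltxx // ltnW.
rewrite leq_eqVlt => /predU1P[->|jN]; last exact: inner.
move=> PiN; rewrite orbit_word_last => lt_si.
have [y [yN Piy le_ys]] := dn _ (ltnW iN) PiN.
have lt_yi : (orbit_word s y < orbit_word s i)%O by apply: le_lt_trans lt_si.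
apply/agree_sym.
have /agree_sym e : agree m.+1 (orbit_word s y) (orbit_word s i).
  apply: inner => //.
  rewrite ltn_neqAle Piy andbT; apply: contraTneq lt_yi => e.
  by rewrite (P_inj _ _ e) ?ltxx // ltnW.
have ys := agree_between le_ys (ltW lt_si) (agree_sym e).
exact: agree_trans e ys.
Qed.

(** With strict hypotheses equal orbit words are excluded too: two equal ones
    would, after removing common letters, give an orbit word equal to [s], which
    [orbit_monotone] contradicts at the position provided by the hypotheses. *)
Lemma orbit_iso s :
  (forall j, j <= N -> P N < P j ->
     exists x, [/\ x < N, P x <= P j & (s < orbit_word s x)%O]) ->
  (forall j, j <= N -> P j < P N ->
     exists y, [/\ y < N, P j <= P y & (orbit_word s y < s)%O]) ->
  forall i j, i <= N -> j <= N -> P i < P j ->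
    (orbit_word s i < orbit_word s j)%O.
Proof.
move=> up dn.
have mono : forall i j, i <= N -> j <= N -> P i < P j ->
    (orbit_word s i <= orbit_word s j)%O.
  apply: orbit_monotone => j jN.
    by case/(up _ jN) => x [xN Pxj /ltW le_sx]; exists x.
  by case/(dn _ jN) => y [yN Pyj /ltW le_sy]; exists y.
have ltP i j : i <= N -> j <= N -> (orbit_word s i < orbit_word s j)%O ->
    P i <= P j.
  move=> iN jN lt_ij; rewrite leqNgt; apply/negP => /(mono _ _ jN iN).
  by rewrite leNgt lt_ij.
have last_neq i : i < N -> orbit_word s i != s.
  move=> iN; have nPi : P i != P N.
    by apply/eqP => /(P_inj (ltnW iN) (leqnn N)) e; rewrite e ltnn in iN.
  apply/negP => /eqP e; move: nPi; rewrite neq_ltn => /orP[lt|lt].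
    have [y [yN Piy lt_ys]] := dn _ (ltnW iN) lt.
    move: (lt_ys); rewrite -{2}e => /(ltP _ _ (ltnW yN) (ltnW iN)) Pyi.
    have/(P_inj (ltnW iN) (ltnW yN)) eyi : P i = P y.
      by apply/eqP; rewrite eqn_leq Piy Pyi.
    by move: lt_ys; rewrite -eyi e ltxx.
  have [x [xN Pxi lt_sx]] := up _ (ltnW iN) lt.
  move: (lt_sx); rewrite -{1}e => /(ltP _ _ (ltnW iN) (ltnW xN)) Pix.
  have/(P_inj (ltnW iN) (ltnW xN)) exi : P i = P x.
    by apply/eqP; rewrite eqn_leq Pix Pxi.
  by move: lt_sx; rewrite -exi e ltxx.
have neq d i j : i + d = N -> j < i -> orbit_word s i != orbit_word s j.
  elim: d i j => [|d IH] i j.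
    by rewrite addn0 => -> /last_neq; rewrite orbit_word_last eq_sym.
  move=> iN ij; have iN' : i < N by rewrite -iN -addSnnS leq_addr.
  rewrite (orbit_word_rec s iN') (orbit_word_rec s (ltn_trans ij iN')).
  apply/eqP => /consw_inj[_ /eqP]; apply/negP; apply: IH => //.
  by rewrite addSnnS.
move=> i j iN jN Pij; rewrite lt_neqAle mono // andbT.
case: (ltngtP i j) => ij.
- by rewrite eq_sym; apply: (@neq (N - j)); rewrite ?subnKC.
- by apply: (@neq (N - i)); rewrite ?subnKC.
- by rewrite ij ltnn in Pij.
Qed.

End Realization.

(** * Returns of a periodic tail *)

(** Think of [R] as the positions from which the orbit word is the periodic word
    itself, of [d] as the length of its least return and of [Q] as the entries.
    A return of odd parity reverses the order, so the entries at
    [i0 + d, i0, i0 - d, ...] alternate around the one at [i0 + d]. They cannot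
    spiral inwards when some entry lies below, so they move outwards, and the
    first two are the closest on either side. *)
Lemma odd_return_neighbours (R : pred nat) (Q : nat -> nat) (i0 d y : nat) :
  0 < d -> R i0 -> (forall i, R i -> i <= i0) ->
  (forall i, R i -> i != i0 -> R (i + d)) ->
  (forall i, R i -> Q i != Q (i0 + d)) ->
  (forall i j, R i -> R j -> i != j -> (Q i < Q j) = ~~ (Q (i + d) < Q (j + d))) ->
  Q (i0 + d) < Q i0 -> R y -> Q y < Q (i0 + d) ->
  exists i1, [/\ i1 + d = i0, R i1, Q i1 < Q (i0 + d) &
    forall i, R i -> Q i0 <= Q i \/ Q i <= Q i1].
Proof.
move=> d0 R0 Rle RD Qneq step lt0 Ry lty.
(* Descent along the returns: each of them reaches i0 by steps of d. *)
have Rind (C : nat -> Prop) : C i0 ->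
    (forall i, R i -> i != i0 -> C (i + d) -> C i) -> forall i, R i -> C i.
  move=> C0 CS i Ri; have [m] := ubnP (i0 - i); elim: m i Ri => // m IH i Ri im.
  have [->//|ni] := eqVneq i i0.
  have := Rle _ Ri; have := Rle _ (RD _ Ri ni) => le1 le2.
  by apply: CS => //; apply: IH; [exact: RD|lia].
have [i1 [i1d R1]] : exists i1, i1 + d = i0 /\ R i1.
  have: y != i0 by apply: contraTneq lty => ->; lia.
  move: (y) Ry; apply: Rind; first by rewrite eqxx.
  move=> i Ri ni IH _; case: (eqVneq (i + d) i0) => [e|/IH//].
  by exists i.
have ni1 : i1 != i0 by lia.
have lt10 : (Q i1 < Q i0) = ~~ (Q i0 < Q (i0 + d)) by rewrite step ?i1d.
have [lt1|ge1] := ltnP (Q i1) (Q (i0 + d)).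
  exists i1; split=> //; apply: Rind; first by left.
  move=> i Ri ni [] IH.
    case: (eqVneq (i + d) i0) => [e|nid]; first by right; have -> : i = i1 by lia.
    have nii1 : i != i1 by lia.
    have := step _ _ R1 Ri; rewrite eq_sym nii1 i1d => /(_ isT).
    suff -> : Q i0 < Q (i + d) by lia.
    have := step _ _ Ri R1 nii1; have := step _ _ R1 Ri.
    rewrite eq_sym nii1 i1d => /(_ isT) e1 e2; lia.
  have := step _ _ Ri R0 ni; have -> : Q (i + d) < Q (i0 + d) by lia.
  by left; lia.
(* Inward spiral: every entry stays between those at i1 and i0. *)
suff: Q i1 <= Q y /\ Q y <= Q i0 by lia.
move: (y) Ry; apply: Rind; first by lia.
move=> i Ri ni [IH1 IH2].
case: (eqVneq (i + d) i0) => [e|nid].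
  by have -> : i = i1; lia.
have nii1 : i != i1 by lia.
have e1 := step _ _ Ri R0 ni; have e2 := step _ _ Ri R1 nii1.
have e3 := step _ _ R1 Ri; rewrite eq_sym nii1 i1d in e3; rewrite i1d in e2.
have {}e3 := e3 isT; have n1 := Qneq _ R1; lia.
Qed.

Section Returns.
Variables (k : nat) (sigma : k.-tuple sign) (c0 : 'I_k).
Variables (zeta : seq 'I_k) (P : nat -> nat).
Implicit Types (s : word sigma).

Local Notation N := (size zeta).
Local Notation z := (nth c0 zeta).
Local Notation T := (T_minus sigma).
Local Notation orbit_word := (@orbit_word k sigma zeta).

Hypothesis P_inj : forall i j, i <= N -> j <= N -> P i = P j -> i = j.
Hypothesis P_compat : compatible sigma c0 zeta P.

Lemma orbit_strip d i j : i + d <= N -> j + d <= N -> i != j ->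
  take d (drop i zeta) = take d (drop j zeta) ->
  (P i < P j) = parity sigma (take d (drop i zeta)) (+) (P (i + d) < P (j + d)).
Proof.
elim: d i j => [|d IH] i j iN jN nij; first by rewrite !take0 !addn0.
have {}iN' : i < N by lia. have {}jN' : j < N by lia.
rewrite (drop_nth c0 iN') (drop_nth c0 jN') /= => -[ez et].
rewrite (compatE P_inj P_compat iN' jN' nij ez) /parity /= oddD oddb -addbA.
rewrite -!addSnnS; congr (_ (+) _); rewrite IH //; lia.
Qed.

Variables (s : word sigma) (i0 : nat).
Hypothesis i0N : i0 < N.
Hypothesis ret0 : orbit_word s i0 = s.
Hypothesis ret_max : forall i, i < N -> orbit_word s i = s -> i <= i0.

Let d := N - i0.

(** An orbit word equal to [s] starts with the first return word of [s], which is
    shorter by maximality of [i0]. *)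
Lemma return_drop i : i < N -> orbit_word s i = s ->
  drop i zeta = drop i0 zeta ++ drop (i + d) zeta.
Proof.
move=> iN reti; have ii0 := ret_max iN reti.
have -> : i + d = d + i by rewrite addnC.
have sd : size (drop i0 zeta) = d by rewrite size_drop.
rewrite -drop_drop -sd; apply: (@catw_prefix _ sigma _ _ s s).
  by rewrite !size_drop leq_sub2l.
by rewrite -/(orbit_word s i0) -/(orbit_word s i) ret0 reti.
Qed.

Lemma return_step i : i < N -> orbit_word s i = s -> orbit_word s (i + d) = s.
Proof.
move=> iN reti; apply: (@catw_inj _ _ (drop i0 zeta)).
by rewrite -catw_cat -return_drop // -/(orbit_word s i) -/(orbit_word s i0) reti.
Qed.

Lemma return_order i j : i < N -> orbit_word s i = s ->
  j < N -> orbit_word s j = s -> i != j ->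
  (P i < P j) = parity sigma (drop i0 zeta) (+) (P (i + d) < P (j + d)).
Proof.
move=> iN reti jN retj nij.
have sd : size (drop i0 zeta) = d by rewrite size_drop.
have tk i' : i' < N -> orbit_word s i' = s -> take d (drop i' zeta) = drop i0 zeta.
  by move=> i'N ret; rewrite return_drop // take_size_cat.
rewrite (@orbit_strip d) // ?tk //.
- by have := ret_max iN reti; rewrite /d; lia.
- by have := ret_max jN retj; rewrite /d; lia.
Qed.

(** A return of even parity preserves the order, so the entries at earlier and
    earlier returns move away from the last entry monotonically, always on the same
    side. *)
Lemma even_return : ~~ parity sigma (drop i0 zeta) ->
  forall i, i < N -> orbit_word s i = s ->
  (P i < P N) = (P i0 < P N) /\ (i != i0 -> (P i < P i0) = (P i0 < P N)).
Proof.
move=> ev i; have [m] := ubnP (N - i); elim: m i => // m IH i im iN reti.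
have [->|ni] := eqVneq i i0; first by [].
have ii0 : i < i0 by rewrite ltn_neqAle ni ret_max.
have idN : i + d < N by rewrite /d; lia.
have i0d : i0 + d = N by rewrite /d; lia.
have [] := IH (i + d) _ idN (return_step iN reti); first by rewrite /d; lia.
move=> IH1 _.
have := return_order iN reti i0N ret0 ni.
rewrite (negbTE ev) /= i0d IH1 => e; split=> //.
have := P_ltn P_inj (ltnW iN) (ltnW i0N) ni.
have n0 : i0 != N by lia.
have := P_ltn P_inj (ltnW i0N) (leqnn N) n0; lia.
Qed.

End Returns.

Section Gap.
Variables (k : nat) (sigma : k.-tuple sign) (c0 : 'I_k).
Variables (zeta : seq 'I_k) (P : nat -> nat).
Implicit Types (s : word sigma).

Local Notation N := (size zeta).
Local Notation z := (nth c0 zeta).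
Local Notation T := (T_minus sigma).
Local Notation orbit_word := (@orbit_word k sigma zeta).
Local Notation per := (@per k sigma c0).

Hypothesis P_inj : forall i j, i <= N -> j <= N -> P i = P j -> i = j.
Hypothesis P_compat : compatible sigma c0 zeta P.

Lemma last_return s i : i < N -> orbit_word s i = s ->
  exists i0, [/\ i0 < N, orbit_word s i0 = s &
    forall j, j < N -> orbit_word s j = s -> j <= i0].
Proof.
move=> iN reti; pose R i := (i < N) && (orbit_word s i == s).
have exR : exists i, R i by exists i; rewrite /R iN reti eqxx.
have ubR j : R j -> j <= N by case/andP => /ltnW.
case: (ex_maxnP exR ubR) => i0 /andP[i0N /eqP ret0] max0.
by exists i0; split=> // j jN retj; apply: max0; rewrite /R jN retj eqxx.
Qed.

Lemma drop_nonnil i : i < N -> drop i zeta != [::].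
Proof. by rewrite -size_eq0 size_drop -lt0n subn_gt0. Qed.

Lemma orbit_per x : x < N -> orbit_word (per (drop x zeta)) x = per (drop x zeta).
Proof. by move=> xN; apply/per_catw/drop_nonnil. Qed.

(** Here [x] and [y] hold the entries next to the last one, [p] and [q] are the
    suffixes of the prefix starting there. The tail [s = p p p ...] satisfies the
    hypotheses of [orbit_monotone] with [x] on both sides, since [p s = s]; so
    [q s <= s], and strictness is the claim, by [lt_per]. If [q s = s], then both
    [x] and [y] are returns of [s] lying on opposite sides of the last entry.
    The least return is then odd, and its first two occurrences are the closest
    positions on the two sides, so one of [p], [q] is the square of the
    other. *)
Lemma per_gap x y : x < N -> y < N ->
  P N < P x -> (forall j, j < N -> P N < P j -> P x <= P j) ->
  P y < P N -> (forall j, j < N -> P j < P N -> P j <= P y) ->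
  drop x zeta != drop y zeta ++ drop y zeta ->
  drop y zeta != drop x zeta ++ drop x zeta ->
  (per (drop y zeta) < per (drop x zeta))%O.
Proof.
move=> xN yN Px adjx Py adjy npq nqp.
set s := per (drop x zeta).
have retx : orbit_word s x = s by apply: orbit_per.
have nN j : j <= N -> j != N -> j < N by lia.
have le_ys : (orbit_word s y <= s)%O.
  rewrite -[X in (_ <= X)%O](orbit_word_last zeta s).
  apply: (orbit_monotone P_inj P_compat) Py => //; last exact: ltnW.
    move=> j jN Pj; exists x; rewrite retx lexx; split=> //; apply: adjx => //.
    by apply: nN => //; apply: contraTneq Pj => ->; rewrite ltnn.
  by move=> j jN Pj; exists x; rewrite retx lexx; split=> //; lia.
have nily := drop_nonnil yN.
move: le_ys; rewrite le_eqVlt => /predU1P[rety|]; last first.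
  by rewrite /orbit_word (lt_per c0 _ nily).2.
have [i0 [i0N ret0 max0]] := last_return xN retx.
have n0 : i0 != N by lia.
have Pn0 := P_ltn P_inj (ltnW i0N) (leqnn N) n0.
case par : (parity sigma (drop i0 zeta)); last first.
  have ev := even_return P_inj P_compat i0N ret0 max0 (negbT par).
  have [e1 _] := ev _ xN retx; have [e2 _] := ev _ yN rety; lia.
pose R i := (i < N) && (orbit_word s i == s).
set d := N - i0; have i0d : i0 + d = N by rewrite /d; lia.
have d0 : 0 < d by rewrite /d; lia.
have RP i : R i -> i < N /\ orbit_word s i = s by case/andP => ? /eqP.
have R0 : R i0 by rewrite /R i0N ret0 eqxx.
have Rmax i : R i -> i <= i0 by case/RP; apply: max0.
have RD i : R i -> i != i0 -> R (i + d).
  move=> Ri ni; have := Rmax _ Ri; have [iN reti] := RP _ Ri => ii0.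
  by rewrite /R (return_step ret0 max0 iN reti) eqxx andbT /d; lia.
have Rneq i : R i -> P i != P (i0 + d).
  move=> /RP [iN _]; rewrite i0d; apply/eqP => /(P_inj (ltnW iN) (leqnn N)); lia.
have Rstep i j : R i -> R j -> i != j -> (P i < P j) = ~~ (P (i + d) < P (j + d)).
  move=> /RP [iN reti] /RP [jN retj] nij.
  by rewrite (return_order P_inj P_compat i0N ret0 max0 iN reti jN retj nij) par.
have Rx : R x by rewrite /R xN retx eqxx.
have Ry : R y by rewrite /R yN rety eqxx.
have double i : i + d = i0 -> R i -> drop i zeta = drop i0 zeta ++ drop i0 zeta.
  by move=> e /RP [iN reti]; rewrite {1}(return_drop ret0 max0 iN reti) -/d e.
have [lt0|ge0] := ltnP (P N) (P i0).
  case: (@odd_return_neighbours R P i0 d y); rewrite ?i0d //.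
  by move=> i; rewrite -i0d; apply: Rneq.
  move=> i1 [i1d R1 lt1 far]; have [i1N _] := RP _ R1.
  have ex : x = i0.
    apply: (P_inj (ltnW xN) (ltnW i0N)).
    by have := adjx _ i0N lt0; have := far _ Rx; lia.
  have ey : y = i1.
    apply: (P_inj (ltnW yN) (ltnW i1N)).
    by have := adjy _ i1N lt1; have := far _ Ry; lia.
  by move: nqp; rewrite ex ey double // eqxx.
have lt0 : P i0 < P N by rewrite ltn_neqAle ge0 andbT -i0d Rneq.
(* The mirror image of the previous case: subtracting from M reverses the order. *)
pose M := \max_(i < N.+1) P i.
have PM i : i <= N -> P i <= M.
  by rewrite -ltnS => iN; have := @leq_bigmax _ (fun i : 'I_N.+1 => P i) (Ordinal iN).
have PMi i : R i -> P i <= M by move=> /RP [/ltnW /PM].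
have RN i : R i -> i + d <= N by move=> /Rmax; lia.
case: (@odd_return_neighbours R (fun i => M - P i) i0 d x); rewrite ?i0d //.
- move=> i Ri; have := Rneq _ Ri; rewrite i0d.
  have := PMi _ Ri; have := PM _ (leqnn N); lia.
- move=> i j Ri Rj nij; rewrite -(negbK (M - P i < _)); congr (~~ _).
  have nji : j != i by rewrite eq_sym.
  have := Rstep _ _ Rj Ri nji; have := Rstep _ _ Ri Rj nij.
  have [iN _] := RP _ Ri; have [jN _] := RP _ Rj.
  have := P_ltn P_inj (ltnW iN) (ltnW jN) nij.
  have nijd : i + d != j + d by lia.
  have := P_ltn P_inj (RN _ Ri) (RN _ Rj) nijd.
  have := PMi _ Ri; have := PMi _ Rj.
  have := PM _ (RN _ Ri); have := PM _ (RN _ Rj); lia.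
- have := PM _ (leqnn N); have := PMi _ R0; lia.
- have := PM _ (leqnn N); have := PMi _ Rx; lia.
move=> i1 [i1d R1 lt1 far]; have [i1N _] := RP _ R1.
have lt1' : P N < P i1 by lia.
have ey : y = i0.
  apply: (P_inj (ltnW yN) (ltnW i0N)).
  have := adjy _ i0N lt0; have := far _ Ry.
  have := PMi _ Ry; have := PMi _ R0; have := PMi _ R1; lia.
have ex : x = i1.
  apply: (P_inj (ltnW xN) (ltnW i1N)).
  have := adjx _ i1N lt1'; have := far _ Rx.
  have := PMi _ Rx; have := PMi _ R0; have := PMi _ R1; lia.
by move: npq; rewrite ex ey double // eqxx.
Qed.

(** Prepending [p p], an even word, moves [q q q ...] strictly towards
    [p p p ...] without passing it. *)
Lemma between_per x y : x < N -> y < N ->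
  (per (drop y zeta) < per (drop x zeta))%O ->
  exists s, (s < orbit_word s x)%O /\ (orbit_word s y < s)%O.
Proof.
move=> xN yN lt_yx; have nx := drop_nonnil xN; have ny := drop_nonnil yN.
set p := drop x zeta in lt_yx nx *; set q := drop y zeta in lt_yx ny *.
have pp : catw (p ++ p) (per p) = per p by rewrite catw_cat !per_catw.
have nxx : p ++ p != [::] by rewrite -size_eq0 size_cat addn_eq0 size_eq0 (negbTE nx).
exists (catw (p ++ p) (per q)).
rewrite /orbit_word (lt_per c0 _ nx).1 (lt_per c0 _ ny).2 -/p -/q; split.
  rewrite -[X in (_ < X)%O]pp lt_catw /parity count_cat oddD addbb; exact: lt_yx.
by rewrite (lt_per c0 _ nxx).1 -(per_unique c0 nxx pp).
Qed.

End Gap.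

(** * Extreme periodic tails *)

Section ExtremeCase.
Variables (k : nat) (sigma : k.+2.-tuple sign).
Variables (zeta : seq 'I_k.+2) (P : nat -> nat).

Local Notation N := (size zeta).
Local Notation z := (nth ord0 zeta).
Local Notation T := (T_minus sigma).
Local Notation shift := (@signed_shift k.+2 sigma).
Local Notation orbit_word := (@orbit_word k.+2 sigma zeta).
Local Notation lett := (@extreme_letter k).
Local Notation flip := (flip_side sigma).

Hypothesis P_inj : forall i j, i <= N -> j <= N -> P i = P j -> i = j.
Hypothesis P_compat : compatible sigma ord0 zeta P.

(** Let the last entry be the least ([b = false]) or the greatest ([b = true])
    one, and let [p] start at the position [x] of its only neighbour. A tail beyond
    [p p p ...] is needed, and fails to exist only if [p p p ...] is extreme. Then
    its least return has length one or two and is even, so it starts at [x] by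
    [even_return]. *)
Lemma extreme_neighbour x b : x < N ->
  (forall j, j < N -> (P N < P j) = ~~ b) ->
  (forall j, j < N -> j != x -> (P j < P x) = b) ->
  per sigma ord0 (drop x zeta) = extreme_word sigma b ->
  [/\ x.+1 = N, T (lett b) = false & z x = lett b] \/
  [/\ x.+2 = N, T (lett b) /\ T (lett (~~ b)),
      z x = lett b /\ z x.+1 = lett (~~ b) &
      forall j, j <= N -> j != x.+1 -> (P j < P x.+1) = ~~ b].
Proof.
move=> xN Pend Pnext; set s := per _ _ _ => es.
have retx : orbit_word s x = s by apply: orbit_per.
have orbitE i : i <= N - x -> orbit_word s (x + i) = extreme_word sigma (iter i flip b).
  elim: i => [|i IH] iN; first by rewrite addn0 retx es.
  have ixN : x + i < N by lia.
  have := IH (ltnW iN); rewrite (orbit_word_rec ord0 s ixN) extreme_word_rec.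
  by case/consw_inj => _; rewrite addnS.
have zE i : i < N - x -> z (x + i) = lett (iter i flip b).
  move=> iN; have ixN : x + i < N by lia.
  have := orbitE i (ltnW iN); rewrite (orbit_word_rec ord0 s ixN) extreme_word_rec.
  by case/consw_inj.
have back : iter (N - x) flip b = b.
  apply: (@extreme_letter_inj k); have := orbitE _ (leqnn _).
  rewrite subnKC ?(ltnW xN) // orbit_word_last es => /(congr1 (fun w => w 0)).
  by rewrite /extreme_word.
have [i0 [i0N ret0 max0]] := last_return xN retx.
have xi0 : ~~ parity sigma (drop i0 zeta) -> x = i0.
  move=> ev; apply/eqP/negPn/negP => nx.
  have := (even_return P_inj P_compat i0N ret0 max0 ev xN retx).2 nx.
  have n0 : i0 != N by lia.
  have nx' : i0 != x by rewrite eq_sym.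
  have := P_ltn P_inj (ltnW i0N) (leqnn N) n0.
  have := P_ltn P_inj (ltnW i0N) (ltnW xN) nx'.
  have := Pnext _ i0N nx'; have := Pend _ i0N; lia.
case Tb : (T (lett b)); last first.
  left; have flipb i : iter i flip b = b.
    by elim: i => //= i ->; rewrite /flip_side Tb addbF.
  have i0E : i0.+1 = N.
    have : N.-1 <= i0; last by lia.
    apply: max0; first by lia.
    have -> : N.-1 = x + (N.-1 - x) by lia.
    by rewrite orbitE ?flipb ?es //; lia.
  have zi : z i0 = lett b.
    have -> : i0 = x + (i0 - x) by have := max0 _ xN retx; lia.
    by rewrite zE ?flipb //; lia.
  have -> : x = i0; last by split.
  apply: xi0; rewrite (drop_nth ord0 i0N) i0E drop_size /parity /= zi Tb.
  by [].
have flipb : flip b = ~~ b by rewrite /flip_side Tb addbT.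
have Tnb : T (lett (~~ b)).
  apply/negPn/negP => Tnb; have flipn : flip (~~ b) = ~~ b.
    by rewrite /flip_side (negbTE Tnb) addbF.
  have iterE i : iter i.+1 flip b = ~~ b by elim: i => //= i ->.
  have : N - x = (N - x).-1.+1 by lia.
  by move=> e; move: back; rewrite e iterE; case: (b).
have flipn : flip (~~ b) = b by rewrite /flip_side Tnb addbT negbK.
have iterE i : iter i flip b = odd i (+) b.
  by elim: i => //= i ->; case: (odd i) => /=; rewrite ?addTb ?addFb ?flipb ?flipn.
(* Both extreme letters are negative, so the extreme words have period two. *)
have oddx : odd (N - x) = false.
  by move: back; rewrite iterE; case: (odd _); case: (b).
have ltx2 : x.+1 < N.
  have nx1 : N - x != 1 by apply: contraFneq oddx => ->.
  lia.
have iter2 : iter (N - x - 2) flip b = b by rewrite iterE oddB ?oddx //; lia.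
have i0E : i0.+2 = N.
  have : N - 2 <= i0.
    apply: max0; first by lia.
    have -> : N - 2 = x + (N - x - 2) by lia.
    rewrite orbitE; last by lia.
    by rewrite iter2 es.
  have : i0.+1 != N; last by lia.
  apply/eqP => e; have := ret0.
  have -> : i0 = x + (N - x).-1 by lia.
  rewrite orbitE; last by lia.
  have oddx1 : odd (N - x).-1.
    have : odd (N - x).-1.+1 = false by rewrite prednK ?oddx //; lia.
    by move=> /= /negbFE.
  rewrite iterE oddx1 es => /(congr1 (fun w => w 0)) /(@extreme_letter_inj k).
  by case: (b).
have i01N : i0.+1 < N by lia.
have ei0 : i0 = x + (N - x - 2) by lia.
have z0 : z i0 = lett b.
  by rewrite ei0 zE ?iter2 //; lia.
have z1 : z i0.+1 = lett (~~ b).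
  by rewrite ei0 -addnS zE /= ?iter2 ?flipb //; lia.
have ex : x = i0.
  apply: xi0; rewrite (drop_nth ord0 i0N) (drop_nth ord0 i01N) i0E drop_size.
  by rewrite /parity /= z0 z1 Tb Tnb.
right; rewrite ex; split=> // j jN nj.
move: jN; rewrite leq_eqVlt => /predU1P[->|jN]; first exact: Pend.
have nj' : i0.+1 != j by rewrite eq_sym.
have Pj := P_ltn P_inj (ltnW jN) (ltnW i01N) nj.
apply: contrapT => bad.
(* An entry beyond the one at i0.+1 would have the same extreme negative letter,
   so its successor would lie beyond the extreme entry at N. *)
have zj : z j = lett (~~ b).
  apply/val_inj/eqP; rewrite eqn_leq; case eb: b bad z1 => /= bad z1.
    have lt : P j < P i0.+1 by lia.
    by have [] := P_compat jN i01N lt; rewrite z1 /= => ->; rewrite leq0n.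
  have lt : P i0.+1 < P j by lia.
  by have [] := P_compat i01N jN lt; rewrite z1 /= => ->; rewrite leq_ord.
have eqz : z j = z i0.+1 by rewrite zj z1.
have := compatE P_inj P_compat jN i01N nj eqz; rewrite zj Tnb i0E.
have nj1 : j.+1 != N by rewrite -i0E eqSS.
have j1N : j.+1 < N by lia.
have := Pend _ j1N; have := P_ltn P_inj jN (leqnn N) nj1; lia.
Qed.

End ExtremeCase.

(** * One-line notation and monotone blocks *)

Lemma sorted_map_ltn (r : rel nat) (G : nat -> nat) (t : seq nat) :
  transitive r -> sorted ltn t ->
  sorted r (map G t) <-> forall u v, u \in t -> v \in t -> u < v -> r (G u) (G v).
Proof.
move=> r_tr t_lt; split=> [Gt_r u v ut vt uv|Gr]; last first.
  by apply: (@homo_sorted_in _ _ (mem t) G ltn r) => //; apply/allP.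
have uv_idx : index u t < index v t.
  rewrite ltnNge; apply/negP; rewrite leq_eqVlt => /predU1P[e|].
    by move: uv; rewrite -(nth_index 0 ut) -e nth_index // ltnn.
  by move/(sorted_ltn_index ltn_trans t_lt _ _ vt ut) => /(ltn_trans uv); rewrite ltnn.
have := sorted_ltn_nth r_tr 0 Gt_r _ _ _ _ uv_idx.
rewrite !(nth_map 0) ?index_mem // !nth_index // => -> //.
- by rewrite inE size_map index_mem.
- by rewrite inE size_map index_mem.
Qed.

Section OneLine.
Variables (N : nat) (pi : 'S_N.+1).

Definition entry i : nat := nth 0 (one_line pi) i.

Local Notation P := entry.
Local Notation L := (one_line pi).

Lemma size_one_line : size L = N.+1.
Proof. by rewrite size_map size_enum_ord. Qed.

Lemma entry_ord (i : 'I_N.+1) : P i = (pi i).+1.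
Proof. by rewrite /P (nth_map ord0) ?size_enum_ord // nth_ord_enum. Qed.

Lemma uniq_one_line : uniq L.
Proof.
rewrite map_inj_uniq ?enum_uniq // => i j [] /val_inj; exact: perm_inj.
Qed.

Lemma entry_inj i j : i <= N -> j <= N -> P i = P j -> i = j.
Proof.
move=> iN jN /eqP; rewrite /P nth_uniq ?size_one_line ?uniq_one_line //.
by move/eqP.
Qed.

Lemma entry_bounds i : i <= N -> 0 < P i <= N.+1.
Proof. by rewrite -ltnS => iN; rewrite (entry_ord (Ordinal iN)) ltnS ltn_ord. Qed.

Lemma entry_onto v : 0 < v <= N.+1 -> exists i, i <= N /\ P i = v.
Proof.
case: v => // v; rewrite ltnS => /= vN.
exists ((pi^-1)%g (Ordinal vN)); split; first by rewrite -ltnS ltn_ord.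
by rewrite entry_ord permKV.
Qed.

Lemma index_entry i : i <= N -> index (P i) L = i.
Proof. by move=> iN; rewrite /P index_uniq ?uniq_one_line ?size_one_line. Qed.

Lemma last_entryE : last_entry pi = P N.
Proof. by rewrite /last_entry -nth_last size_one_line. Qed.

Lemma suffix2E a b :
  suffix [:: a; b] L = [&& 0 < N, P N.-1 == a & P N == b].
Proof.
rewrite suffixE size_one_line /= subSS.
case: (posnP N) => [N0|N0].
  have sL : size L = 1 by rewrite size_one_line; lia.
  have -> : N - 1 = 0 by lia.
  by move: sL; rewrite drop0; case: (one_line pi) => [|c [|c' l]] //;
     rewrite eqseq_cons andbF.
have sN : N.-1.+1 = N by rewrite prednK.
rewrite subn1 (drop_nth 0) ?size_one_line; last lia.
rewrite sN (drop_nth 0) ?size_one_line // drop_oversize ?size_one_line //.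
by rewrite !eqseq_cons andbT.
Qed.

Lemma suffix3E a b c :
  suffix [:: a; b; c] L = [&& 1 < N, P N.-2 == a, P N.-1 == b & P N == c].
Proof.
rewrite suffixE size_one_line /= !subSS.
case: (leqP N 1) => [N0|N0].
  have -> : N - 2 = 0 by lia.
  have sL : size L <= 2 by rewrite size_one_line.
  by rewrite drop0; move: sL; case: (one_line pi) => [|d [|d' [|d'' l]]] //=;
     rewrite !eqseq_cons ?andbF.
have sN : N.-1.+1 = N by lia.
have sN' : N.-2.+1 = N.-1 by lia.
have -> : N - 2 = N.-2 by lia.
rewrite (drop_nth 0) ?size_one_line; last lia.
rewrite sN' (drop_nth 0) ?size_one_line; last lia.
rewrite sN (drop_nth 0) ?size_one_line // drop_oversize ?size_one_line //.
by rewrite !eqseq_cons andbT.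
Qed.

Lemma monotone_blockP (s : sign) a b : b <= N.+1 ->
  monotone_block pi s a b <->
  forall i j, i < N -> j < N -> a < P i -> P i < P j -> P j <= b ->
    (P i.+1 < P j.+1) = (if s is Plus then true else false).
Proof.
move=> bN; pose t := [seq v <- iota a.+1 (b - a) | (index v L).+1 < N.+1].
pose G v := P (index v L).+1.
have blockE : block pi a b = map G t.
  have -> : block pi a b = pmap (fun v =>
      if (index v L).+1 < N.+1 then Some (G v) else None) (iota a.+1 (b - a)).
    rewrite /block /marked_cycle -map_take -map_drop take_iota drop_iota.
    rewrite (minn_idPl bN) add1n.
    by elim: (iota _ _) => //= v l <-; case: ifP.
  rewrite /t; elim: (iota _ _) => //= v l ->; case: ifP => //.
have t_lt : sorted ltn t by apply: sorted_filter (iota_ltn_sorted _ _); exact: ltn_trans.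
have tP i : i < N -> (P i \in t) = (a < P i <= b).
  move=> iN; rewrite mem_filter (index_entry (ltnW iN)) ltnS iN mem_iota /=.
  lia.
have tE v : v \in t -> exists2 i, i < N & v = P i.
  rewrite mem_filter mem_iota ltnS => /andP[vN _]; exists (index v L) => //.
  rewrite /P nth_index // -index_mem size_one_line; lia.
have GE i : i < N -> G (P i) = P i.+1 by move=> iN; rewrite /G index_entry // ltnW.
have neq i j : i < N -> j < N -> P i < P j -> P i.+1 != P j.+1.
  move=> iN jN; apply: contraTneq => /(entry_inj iN jN) [->]; lia.
rewrite /monotone_block blockE; case: s.
  rewrite sorted_map_ltn //; last exact: ltn_trans.
  split=> [h i j iN jN ai ij jb|h u v ut vt].
    by rewrite -(GE i iN) -(GE j jN); apply: h; rewrite ?tP //; lia.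
  have [[i iN eu] [j jN ev]] := (tE _ ut, tE _ vt).
  move: ut vt; rewrite eu ev !tP // !GE //= => ai bj ij; rewrite h //; lia.
rewrite sorted_map_ltn //; last by move=> y x z /= xy yz; exact: ltn_trans yz xy.
split=> [h i j iN jN ai ij jb|h u v ut vt].
  have := h (P i) (P j); rewrite !tP // !GE //= => {}h.
  by have := h _ _ ij; lia.
have [[i iN eu] [j jN ev]] := (tE _ ut, tE _ vt).
move: ut vt; rewrite eu ev !tP // !GE //= => ai bj ij; have := neq _ _ iN jN ij.
by have := h _ _ iN jN; lia.
Qed.

End OneLine.

(** * The segmentation of a word *)

Section SegmentationOfWord.
Variables (k : nat) (sigma : k.+2.-tuple sign) (N : nat) (pi : 'S_N.+1).

Local Notation K := k.+2.
Local Notation P := (entry pi).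
Local Notation T := (T_minus sigma).
Local Notation shift := (@signed_shift K sigma).

Lemma T_sigma (c : 'I_K) :
  T c = if sigma_ sigma c is Minus then true else false.
Proof. by rewrite /T_minus /sigma_ (tnth_nth Plus). Qed.

Lemma T_min : T ord0 = if sigma_ sigma 0 is Minus then true else false.
Proof. exact: T_sigma. Qed.

Lemma T_max : T ord_max = if sigma_ sigma K.-1 is Minus then true else false.
Proof. exact: T_sigma. Qed.

Lemma prefix_wordE (E : K.+1.-tuple nat) :
  prefix_word pi E = mkseq (fun i => letter E (P i)) N.
Proof.
apply: (@eq_from_nth _ 0).
  by rewrite size_map size_take size_mkseq size_one_line /= ltnSn.
move=> i; rewrite size_map size_take size_one_line /= ltnSn => iN.
rewrite nth_mkseq // (nth_map 0) ?nth_take //.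
by rewrite size_take size_one_line /= ltnSn.
Qed.

Lemma subword_fromE (E : K.+1.-tuple nat) i : i <= N ->
  subword_from pi E (P i) = drop i (prefix_word pi E).
Proof. by move=> iN; rewrite /subword_from index_entry. Qed.

Section Letter.
Variable E : K.+1.-tuple nat.
Hypothesis E0 : nth 0 E 0 = 0.
Hypothesis EK : nth 0 E K = N.+1.
Hypothesis E_sorted : sorted leq E.

Lemma seg_le s t : s <= t -> t <= K -> nth 0 E s <= nth 0 E t.
Proof.
move=> st tK; apply: (sorted_leq_nth leq_trans leqnn 0 E_sorted) => //.
  by rewrite inE size_tuple ltnS (leq_trans st).
by rewrite inE size_tuple ltnS.
Qed.

Lemma letterP v : 0 < v <= N.+1 ->
  letter E v < K /\ nth 0 E (letter E v) < v <= nth 0 E (letter E v).+1.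
Proof.
move=> /andP[v0 vN]; set a := fun j => nth 0 E j < v <= nth 0 E j.+1.
have has_a : has a (iota 0 K).
  have exE : exists t, v <= nth 0 E t by exists K; rewrite EK.
  case: (ex_minnP exE) => -[|t] vt tmin; first by move: vt; rewrite E0; lia.
  apply/hasP; exists t.
    rewrite mem_iota /= add0n; have := tmin K; rewrite EK vN => /(_ isT); lia.
  rewrite /a vt andbT ltnNge; apply/negP => /tmin; lia.
have lt : find a (iota 0 K) < K by rewrite -{2}(size_iota 0 K) -has_find.
split; first exact: lt.
by have := nth_find 0 has_a; rewrite nth_iota // add0n.
Qed.

Lemma letter_unique v t : 0 < v <= N.+1 -> t < K ->
  nth 0 E t < v <= nth 0 E t.+1 -> letter E v = t.
Proof.
move=> vN tK vt; have [lK vl] := letterP vN; case: (ltngtP (letter E v) t) => // lt.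
  by have := seg_le lt (ltnW tK); lia.
by have := seg_le lt (ltnW lK); lia.
Qed.

End Letter.

Section FromWord.
Variable w : word sigma.
Hypothesis w_order : forall i j, i <= N -> j <= N ->
  (P i < P j) = (iter i shift w < iter j shift w)%O.

Lemma tail_rec i : iter i shift w = consw (w i) (iter i.+1 shift w).
Proof. by rewrite iterS -[LHS]consw_eta iter_shift addn0. Qed.

Lemma w_mono i j : i <= N -> j <= N -> P i <= P j -> w i <= w j.
Proof.
move=> iN jN; rewrite leq_eqVlt => /predU1P[/(entry_inj iN jN) ->//|].
rewrite w_order // tail_rec [iter j _ _]tail_rec word_lt_rec /=.
by case/orP => [/ltnW//|/andP[/eqP ->]].
Qed.

Lemma w_step i j : i < N -> j < N -> P i < P j -> w i = w j ->
  (P i.+1 < P j.+1) = ~~ T (w i).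
Proof.
move=> iN jN Pij wij; have nij : i.+1 != j.+1.
  by rewrite eqSS; apply: contraTneq Pij => ->; rewrite ltnn.
have := Pij; rewrite (w_order (ltnW iN) (ltnW jN)).
rewrite tail_rec [iter j _ _]tail_rec -wij lt_consw -!w_order //.
by case: (T (w i)) => // /ltn_geF h; apply/negbTE; rewrite -leqNgt ltnW // ltnNge h.
Qed.

(** The letters below [t] are those of the entries up to [cut t]. Taking the
    maximum over the positions that have a letter in the prefix makes a cut never
    equal to the last entry, as condition (f) requires. *)
Definition cut t : nat :=
  if t < K then \max_(i < N | w i < t) P i else N.+1.

Lemma cutP t i : t < K -> i < N -> (P i <= cut t) = (w i < t).
Proof.
move=> tK iN; rewrite /cut tK; apply/idP/idP => [|wi]; last first.
  exact: (@leq_bigmax_cond _ _ (fun j : 'I_N => P j) (Ordinal iN)).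
apply: contraLR; rewrite -leqNgt -ltnNge => ti.
have /andP[P0 _] := entry_bounds pi (ltnW iN).
rewrite -(prednK P0) ltnS; apply/bigmax_leqP => j wj.
rewrite -ltnS prednK // ltnNge; apply/negP => Pij.
have := w_mono (ltnW iN) (ltnW (ltn_ord j)) Pij; lia.
Qed.

Lemma cut_le t : cut t <= N.+1.
Proof.
rewrite /cut; case: ifP => // _; apply/bigmax_leqP => j _.
by have /andP[] := entry_bounds pi (ltnW (ltn_ord j)).
Qed.

Lemma cut_attained t : t < K -> cut t != 0 ->
  exists i, [/\ i < N, w i < t & cut t = P i].
Proof.
move=> tK; rewrite /cut tK => n0.
have [j wj] : exists j : 'I_N, w j < t.
  apply: contrapT => /forallNP none; move/eqP: n0; apply.
  by apply: big1 => j wj; case: (none j).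
have [i wi ->] := @eq_bigmax_cond _ (fun i : 'I_N => w i < t) (fun i => P i)
  (introT card_gt0P (ex_intro _ j wj)).
by exists i; split=> //; exact: wi.
Qed.

Definition cut_tuple : K.+1.-tuple nat := mktuple (fun t : 'I_K.+1 => cut t).

Lemma nth_cut t : t <= K -> nth 0 cut_tuple t = cut t.
Proof.
by rewrite -ltnS => tK; have := nth_mktuple (fun t : 'I_K.+1 => cut t) 0 (Ordinal tK).
Qed.

Lemma cut_mono s t : s <= t -> cut s <= cut t.
Proof.
move=> st; rewrite {2}/cut; case: ifP => tK; last exact: cut_le.
rewrite /cut (leq_ltn_trans st tK); apply/bigmax_leqP => j wj.
by apply: (@leq_bigmax_cond _ _ (fun j : 'I_N => P j)); exact: leq_trans wj st.
Qed.

Lemma cut_letter i : i < N -> letter cut_tuple (P i) = w i.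
Proof.
move=> iN; apply: letter_unique.
- by rewrite nth_cut // /cut /= big_pred0.
- by rewrite nth_cut // /cut ltnn.
- apply/(sortedP 0) => t; rewrite size_tuple ltnS => tK.
  by rewrite !nth_cut ?(ltnW tK) // cut_mono.
- by apply: entry_bounds; exact: ltnW.
- exact: ltn_ord.
- have wK := ltn_ord (w i); rewrite !nth_cut // ?(ltnW wK) //.
  rewrite ltnNge cutP // ltnn /=.
  case: (ltnP (w i).+1 K) => wK1; first by rewrite cutP.
  rewrite /cut ltnNge wK1 /=.
  by have /andP[] := entry_bounds pi (ltnW iN).
Qed.

Lemma last_ne i : i < N -> P i != P N.
Proof.
move=> iN; apply/eqP => /(entry_inj (ltnW iN) (leqnn N)) e.
by rewrite e ltnn in iN.
Qed.

(** Otherwise [v] would lie beyond the extreme word, by [lt_per]. *)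
Lemma extreme_cycle b (A : seq 'I_K) (v : word sigma) : A != [::] ->
  catw A (extreme_word sigma b) = extreme_word sigma b ->
  (if b then catw A v < v else v < catw A v)%O = false.
Proof.
move=> A0 eA; have := extreme_word_bound b v.
by rewrite (per_unique ord0 A0 eA); case: b {eA} => //;
   rewrite ?(lt_per ord0 v A0).1 ?(lt_per ord0 v A0).2.
Qed.

Lemma end_not_extreme i b : i < N ->
  catw (mkseq (fun j => w (i + j)) (N - i)) (extreme_word sigma b) =
    extreme_word sigma b ->
  (if b then P i < P N else P N < P i) = false.
Proof.
move=> iN eA; have := extreme_cycle (iter N shift w) _ eA.
have <- : iter i shift w =
    catw (mkseq (fun j => w (i + j)) (N - i)) (iter N shift w).
  rewrite -{1}(catw_take (N - i) (iter i shift w)) -iterD subnK ?(ltnW iN) //.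
  by congr catw; apply: eq_mkseq => j; rewrite iter_shift.
rewrite -size_eq0 size_mkseq -lt0n subn_gt0 => /(_ iN).
by rewrite !w_order // ltnW.
Qed.

Lemma last_two_not_extreme b : 0 < N -> flip_side sigma b = b ->
  w N.-1 = extreme_letter k b ->
  (if b then P N.-1 < P N else P N < P N.-1) = false.
Proof.
move=> N0 flipb wN; apply: end_not_extreme; first by lia.
have -> : N - N.-1 = 1 by lia.
by rewrite /mkseq /= addn0 wN [in RHS]extreme_word_rec flipb.
Qed.

Lemma last_three_not_extreme b : 1 < N ->
  flip_side sigma b = ~~ b -> flip_side sigma (~~ b) = b ->
  w N.-2 = extreme_letter k b -> w N.-1 = extreme_letter k (~~ b) ->
  (if b then P N.-2 < P N else P N < P N.-2) = false.
Proof.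
move=> N1 flipb flipn w2 w1; apply: end_not_extreme; first by lia.
have -> : N - N.-2 = 2 by lia.
rewrite /mkseq /= addn0 addn1 w2 (_ : N.-2.+1 = N.-1) ?w1; last by lia.
by rewrite [in RHS]extreme_word_rec flipb [in RHS]extreme_word_rec flipn.
Qed.

(** Conditions (b) to (e) forbid the patterns in which the last entry would have
    to lie beyond an extreme word, and validity holds because the last word lies
    strictly between [q q q ...] and [p p p ...], which coincide when one of
    [p], [q] is the square of the other. *)
Lemma word_to_segmentation : exists E : K.+1.-tuple nat, valid_segmentation sigma pi E.
Proof.
have cut_neq t : t < K -> cut t != P N.
  move=> tK; case: (eqVneq (cut t) 0) => [->|/(cut_attained tK) [i [iN _ ->]]].
    by have := entry_bounds pi (leqnn N); lia.
  exact: last_ne.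
have cut1 i : i < N -> (forall j, j < N -> P i <= P j) -> cut 1 != 0 -> w i = ord0.
  move=> iN imin /(cut_attained (isT : 1 < K)) [j [jN wj _]]; apply: val_inj.
  have := w_mono (ltnW iN) (ltnW jN) (imin _ jN); rewrite /=; lia.
have cutK i : i < N -> P i <= cut k.+1 \/ w i = ord_max.
  move=> iN; rewrite cutP //; case: (ltnP (w i) k.+1) => [|wi]; first by left.
  by right; apply: val_inj; have := ltn_ord (w i); rewrite /=; lia.
have bounds i : i < N -> 0 < P i <= N.+1 /\ P i != P N.
  by move=> iN; split; [exact: entry_bounds (ltnW iN)|exact: last_ne].
have cutK_le := cut_le k.+1; have cutK_neq := cut_neq _ (ltnSn k.+1).
exists cut_tuple; split; [split; [|split]|].
- rewrite !nth_cut //; split; first by rewrite /cut /= big_pred0.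
    by rewrite /cut ltnn.
  apply/(sortedP 0) => t; rewrite size_tuple ltnS => tK.
  by rewrite !nth_cut ?(ltnW tK) // cut_mono.
- rewrite !nth_cut // -[cut K.-1]/(cut k.+1); split.
  + move=> t tK; rewrite !nth_cut ?(ltnW tK) //.
    apply/monotone_blockP; first exact: cut_le.
    move=> i j iN jN ai Pij jb.
    have wi : t <= w i by rewrite leqNgt -cutP // -ltnNge.
    have wj : w j <= t.
      case: (ltnP t.+1 K) => tK1; first by rewrite -ltnS -cutP.
      by have := ltn_ord (w j); lia.
    have wij := w_mono (ltnW iN) (ltnW jN) (ltnW Pij).
    have wi_t : w i = t :> nat by lia.
    have ewij : w i = w j by apply: val_inj => /=; lia.
    by rewrite w_step // T_sigma wi_t; case: (sigma_ _ _).
  + move=> s0; rewrite suffix2E => /and3P[N0 /eqP P1 /eqP P2].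
    have N1N : N.-1 < N by lia.
    apply/eqP/negPn/negP => /(cut1 _ N1N) w1.
    suff: (P N < P N.-1) = false by rewrite P1 P2.
    apply: (@last_two_not_extreme false N0).
      by rewrite /flip_side T_min s0.
    by apply: w1 => j jN; have := bounds _ jN; lia.
  + move=> s0; rewrite suffix2E => /and3P[N0 /eqP P1 /eqP P2].
    have N1N : N.-1 < N by lia.
    case: (cutK _ N1N); first by lia.
    move=> w1; suff: (P N.-1 < P N) = false by rewrite P1 P2; lia.
    apply: (@last_two_not_extreme true N0) => //.
    by rewrite /flip_side T_max s0.
  + move=> s0 sK; rewrite suffix3E => /and4P[N1 /eqP P0 /eqP P1 /eqP P2].
    have N1N : N.-1 < N by lia. have N2N : N.-2 < N by lia.
    case: (eqVneq (cut 1) 0) => [|/(cut1 _ N1N) w1]; first by left.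
    case: (cutK _ N2N) => [|w2]; first by right; lia.
    suff: (P N.-2 < P N) = false by rewrite P0 P2; lia.
    apply: (@last_three_not_extreme true N1) => //.
    * by rewrite /flip_side T_max sK.
    * by rewrite /flip_side T_min s0.
    * by apply: w1 => j jN; have := bounds _ jN; lia.
  + move=> s0 sK; rewrite suffix3E => /and4P[N1 /eqP P0 /eqP P1 /eqP P2].
    have N1N : N.-1 < N by lia. have N2N : N.-2 < N by lia.
    case: (eqVneq (cut 1) 0) => [|/(cut1 _ N2N) w2]; first by left.
    case: (cutK _ N1N) => [|w1]; first by right; lia.
    suff: (P N < P N.-2) = false by rewrite P0 P2.
    apply: (@last_three_not_extreme false N1) => //.
    * by rewrite /flip_side T_min s0.
    * by rewrite /flip_side T_max sK.
    * by apply: w2 => j jN; have := bounds _ jN; lia.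
- move=> t tK; rewrite nth_cut; last by lia.
  by rewrite last_entryE; apply/eqP/cut_neq; lia.
rewrite /invalid last_entryE => -[/eqP n1 /eqP nn].
have /andP[PN0 PNN] := entry_bounds pi (leqnn N).
have [x [xN Px]] : exists x, x <= N /\ P x = (P N).+1 by apply: entry_onto; lia.
have [y [yN Py]] : exists y, y <= N /\ P y = (P N).-1 by apply: entry_onto; lia.
have {}xN : x < N by rewrite ltn_neqAle xN andbT; apply: contraPneq Px => ->; lia.
have {}yN : y < N by rewrite ltn_neqAle yN andbT; apply: contraPneq Py => ->; lia.
rewrite -Px -Py !subword_fromE ?(ltnW xN) ?(ltnW yN) // prefix_wordE.
set zeta := mkseq w N.
have -> : mkseq (fun i => letter cut_tuple (P i)) N = map val zeta.
  rewrite -map_comp; apply/eq_in_map => i; rewrite mem_iota add0n => /= iN.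
  exact: cut_letter.
have tailE i : i <= N -> iter i shift w = catw (drop i zeta) (iter N shift w).
  move=> iN; rewrite -{1}(catw_take N w).
  rewrite -{1}(cat_take_drop i (mkseq w N)) catw_cat.
  rewrite -[X in iter X _ _](_ : size (take i (mkseq w N)) = i).
    by rewrite iter_shift_catw.
  by rewrite size_take size_mkseq; case: ltnP => //; lia.
have := w_order (leqnn N) (ltnW xN); have := w_order (ltnW yN) (leqnn N).
rewrite [iter y _ _]tailE ?[iter x _ _]tailE ?(ltnW xN) ?(ltnW yN) // Px Py.
have nil i : i < N -> drop i zeta != [::].
  by rewrite -size_eq0 size_drop size_mkseq -lt0n subn_gt0.
rewrite (lt_per ord0 _ (nil _ xN)).1 (lt_per ord0 _ (nil _ yN)).2.
rewrite prednK // leqnn ltnSn => /esym lt_y /esym lt_x.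
have per2 (A : seq 'I_K) : A != [::] -> per sigma ord0 (A ++ A) = per sigma ord0 A.
  move=> A0; apply/esym/per_unique; last by rewrite catw_cat !per_catw.
  by rewrite -size_eq0 size_cat addn_eq0 size_eq0 (negbTE A0).
have lt := lt_trans lt_y lt_x.
move: zeta nil lt {tailE lt_x lt_y} => zeta nil lt.
by case; rewrite -!map_drop -map_cat => /(inj_map val_inj) e; move: lt;
  rewrite e per2 ?ltxx // nil.
Qed.

End FromWord.
End SegmentationOfWord.

(** * The word of a valid segmentation *)

Section WordOfSegmentation.
Variables (k : nat) (sigma : k.+2.-tuple sign) (N : nat) (pi : 'S_N.+1).

Local Notation K := k.+2.
Local Notation P := (entry pi).
Local Notation T := (T_minus sigma).
Local Notation shift := (@signed_shift K sigma).

Section FromSegmentation.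
Variable E : K.+1.-tuple nat.
Hypothesis E_valid : valid_segmentation sigma pi E.
Local Notation e := (nth 0 E).

Definition segment_word : seq 'I_K := mkseq (fun i => inord (letter E (P i))) N.

Local Notation zeta := segment_word.
Local Notation z := (nth ord0 zeta).

Lemma size_segment_word : size zeta = N.
Proof. exact: size_mkseq. Qed.

Lemma segment_letterP v : 0 < v <= N.+1 ->
  letter E v < K /\ e (letter E v) < v <= e (letter E v).+1.
Proof. by case: E_valid => -[[E0 EK Es] _] _; apply: letterP. Qed.

Lemma segment_wordE i : i < N -> z i = letter E (P i) :> nat.
Proof.
move=> iN; rewrite nth_mkseq // inordK //.
by have [] := segment_letterP (entry_bounds pi (ltnW iN)).
Qed.

Lemma segment_word_prefix : prefix_word pi E = map val zeta.
Proof.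
rewrite prefix_wordE; apply: (@eq_from_nth _ 0).
  by rewrite size_map !size_mkseq.
move=> i; rewrite size_mkseq => iN.
rewrite nth_mkseq // (nth_map ord0) ?size_segment_word //.
exact/esym/segment_wordE.
Qed.

Lemma segment_bounds i : i < N -> e (z i) < P i <= e (z i).+1.
Proof.
move=> iN; rewrite segment_wordE //.
by have [] := segment_letterP (entry_bounds pi (ltnW iN)).
Qed.

Lemma segment_compatible : compatible sigma ord0 zeta P.
Proof.
case: E_valid => -[[E0 EK Es] [[mono _ _ _ _] _]] _.
move=> i j; rewrite size_segment_word => iN jN Pij.
have bi := segment_bounds iN; have bj := segment_bounds jN; split.
  rewrite leqNgt; apply/negP => lt.
  by have := seg_le Es lt (ltnW (ltn_ord (z i))); lia.
move=> ez; have zK := ltn_ord (z i).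
have /monotone_blockP mono_z := mono _ zK.
have := mono_z _ i j iN jN; rewrite T_sigma => ->; first by case: (sigma_ _ _).
- by rewrite -EK; apply: (seg_le Es).
- lia.
- exact: Pij.
- by rewrite ez; lia.
Qed.

Lemma segment_inj i j : i <= size zeta -> j <= size zeta -> P i = P j -> i = j.
Proof. by rewrite size_segment_word; apply: entry_inj. Qed.

Lemma iter_orbit (s : word sigma) i : i <= N ->
  iter i shift (orbit_word zeta s 0) = orbit_word zeta s i.
Proof.
elim: i => [//|i IH] iN; rewrite iterS IH 1?ltnW //.
by rewrite (orbit_word_rec ord0) ?size_segment_word.
Qed.

Lemma neighbour v : 0 < v <= N.+1 -> v != P N -> exists x, x < N /\ P x = v.
Proof.
move=> vN nv; have [x [xN Px]] := entry_onto pi vN; exists x; split=> //.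
rewrite ltn_neqAle xN andbT; apply: contra_neq nv => xe.
by rewrite -Px xe.
Qed.

(** The two configurations left by [extreme_neighbour] are those that conditions
    (b) and (e), for the least word, or (c) and (d), for the greatest one,
    exclude. *)
Lemma extreme_not_per x (b : bool) : x < N ->
  P N = (if b then N.+1 else 1) -> P x = (if b then N else 2) ->
  per sigma ord0 (drop x zeta) <> extreme_word sigma b.
Proof.
case: E_valid => -[[E0 EK Es] [[_ Eb Ec Ed Ee] _]] _.
move=> xN PN Px ep.
have bounds j : j < N -> 0 < P j <= N.+1 /\ P j != P N.
  by move=> jN; split; [apply: entry_bounds; exact: ltnW|exact: last_ne].
have := @extreme_neighbour k sigma zeta P segment_inj segment_compatible x b.
rewrite size_segment_word => /(_ xN) [] //.
- by move=> j /bounds; rewrite PN; case: (b); lia.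
- move=> j jN nj; have nPj : P j != P x.
    by apply: contra_neq nj => /(entry_inj (ltnW jN) (ltnW xN)).
  by have := bounds _ jN; move: nPj; rewrite PN Px; case: (b); lia.
- case=> xN1 Tb zx; have Nx : N.-1 = x by lia.
  have := segment_bounds xN; rewrite zx.
  have N0 : 0 < N by lia.
  case: b PN Px Tb zx {ep} => /= PN Px Tb zx.
    have -> : e k.+1 = N; last by lia.
    apply: Ec; first by move: Tb; rewrite T_max; case: (sigma_ _ _).
    by rewrite suffix2E N0 Nx Px PN !eqxx.
  have -> : e 1 = 0; last by lia.
  apply: Eb; first by move: Tb; rewrite T_min; case: (sigma_ _ _).
  by rewrite suffix2E N0 Nx Px PN !eqxx.
- case=> xN2 [Tb Tnb] [zx zx1] Pfar.
  have Nx : N.-2 = x by lia. have Nx1 : N.-1 = x.+1 by lia.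
  have xN1 : x.+1 < N by lia. have N1 : 1 < N by lia.
  have Px1 : P x.+1 = if b then 1 else N.+1.
    have vN : 0 < (if b then 1 else N.+1) <= N.+1 by case: (b); lia.
    have [j [jN Pj]] := entry_onto pi vN.
    case: (eqVneq j x.+1) => [<- //|/(Pfar _ jN)].
    by have := entry_bounds pi (ltnW xN1); rewrite Pj; case: (b); lia.
  have := segment_bounds xN; have := segment_bounds xN1; rewrite zx zx1.
  have s_min : sigma_ sigma 0 = Minus.
    have : T ord0 by case: b Tb Tnb {ep PN Px zx zx1 Pfar Px1}.
    by rewrite T_min; case: (sigma_ _ _).
  have s_max : sigma_ sigma K.-1 = Minus.
    have : T ord_max by case: b Tb Tnb {ep PN Px zx zx1 Pfar Px1}.
    by rewrite T_max; case: (sigma_ _ _).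
  case: b PN Px Px1 {ep zx zx1 Pfar Tb Tnb} => /= PN Px Px1 b1 b2.
    case: (Ed s_min s_max); rewrite ?suffix3E ?N1 ?Nx ?Nx1 ?Px ?Px1 ?PN ?eqxx //=; lia.
  case: (Ee s_min s_max); rewrite ?suffix3E ?N1 ?Nx ?Nx1 ?Px ?Px1 ?PN ?eqxx //=; lia.
Qed.

(** The tail must lie below [p p p ...] and above [q q q ...], where [p] and [q]
    start at the neighbours of the last entry. If one neighbour is missing, an
    extreme word does. *)
Lemma exists_tail : exists s : word sigma,
  (forall j, j <= N -> P N < P j ->
     exists x, [/\ x < N, P x <= P j & (s < orbit_word zeta s x)%O]) /\
  (forall j, j <= N -> P j < P N ->
     exists y, [/\ y < N, P j <= P y & (orbit_word zeta s y < s)%O]).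
Proof.
have /andP[PN0 PNN] := entry_bounds pi (leqnn N).
have bounds j := @entry_bounds N pi j.
have nil i : i < N -> drop i zeta != [::].
  by move=> iN; apply: drop_nonnil; rewrite size_segment_word.
case: (posnP N) => [N0|N0].
  exists (extreme_word sigma false).
  by split=> j jN; have -> : j = N by [lia]; rewrite ltnn.
case: (eqVneq (P N) 1) => [P1|n1].
  have [x [xN Px]] : exists x, x < N /\ P x = 2 by apply: neighbour; lia.
  exists (extreme_word sigma false); split=> j jN; last first.
    by rewrite P1; have := bounds _ jN; lia.
  move=> lt; exists x; split=> //; first by lia.
  rewrite (lt_per ord0 _ (nil _ xN)).1 lt_neqAle leNgt.
  rewrite (extreme_word_bound false) andbT; apply/eqP => ep.
  by apply: (@extreme_not_per x false).
case: (eqVneq (P N) N.+1) => [P1|nn].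
  have [x [xN Px]] : exists x, x < N /\ P x = N by apply: neighbour; lia.
  exists (extreme_word sigma true); split=> j jN.
    by rewrite P1; have := bounds _ jN; lia.
  move=> lt; exists x; split=> //; first by lia.
  rewrite (lt_per ord0 _ (nil _ xN)).2 lt_neqAle leNgt.
  rewrite (extreme_word_bound true) andbT; apply/eqP => ep.
  by apply: (@extreme_not_per x true).
have [x [xN Px]] : exists x, x < N /\ P x = (P N).+1 by apply: neighbour; lia.
have [y [yN Py]] : exists y, y < N /\ P y = (P N).-1 by apply: neighbour; lia.
have [p_qq q_pp] : drop x zeta != drop y zeta ++ drop y zeta /\
                   drop y zeta != drop x zeta ++ drop x zeta.
  have [_ valid] := E_valid.
  have md i : drop i (map val zeta) = map val (drop i zeta) by rewrite map_drop.
  split; apply/eqP => e; apply: valid; rewrite /invalid last_entryE -Px -Py.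
    rewrite !subword_fromE ?(ltnW xN) ?(ltnW yN) // segment_word_prefix.
    by split; [exact/eqP|exact/eqP|left; rewrite !md e map_cat].
  rewrite !subword_fromE ?(ltnW xN) ?(ltnW yN) // segment_word_prefix.
  by split; [exact/eqP|exact/eqP|right; rewrite !md e map_cat].
have xN' : x < size zeta by rewrite size_segment_word.
have yN' : y < size zeta by rewrite size_segment_word.
have gap : (per sigma ord0 (drop y zeta) < per sigma ord0 (drop x zeta))%O.
  by apply: (per_gap segment_inj segment_compatible) => //;
     rewrite size_segment_word => //; [lia|move=> j _; lia|lia|move=> j _; lia].
have [s [lt_x lt_y]] := between_per xN' yN' gap.
exists s; split=> j jN lt; [exists x|exists y]; split=> //; lia.
Qed.

Lemma segmentation_to_word : exists w : word sigma, forall i j, i <= N -> j <= N ->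
  P i < P j -> (iter i shift w < iter j shift w)%O.
Proof.
have [s [up dn]] := exists_tail; exists (orbit_word zeta s 0) => i j iN jN Pij.
rewrite !iter_orbit //; apply: (orbit_iso segment_inj segment_compatible) => //;
  by rewrite size_segment_word.
Qed.

End FromSegmentation.
End WordOfSegmentation.

Theorem theorem3p6 (k : nat) (hk : 2 <= k) (sigma : k.-tuple sign)
    (n : nat) (hn : 1 <= n) (pi : 'S_n) :
  Allow (@signed_shift k sigma) (existT (fun m => 'S_m) n pi) <->
  exists E : k.+1.-tuple nat, valid_segmentation sigma pi E.
Proof.
case: k hk sigma => [|[|k]] // _ sigma; case: n hn pi => [//|N] _ pi.
split=> [[_ /= [w /PatP [_ w_pat]]]|[E /segmentation_to_word [w w_lt]]].
  apply: (@word_to_segmentation _ _ _ _ w) => i j iN jN.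
  rewrite -ltnS in iN; rewrite -ltnS in jN.
  rewrite (entry_ord pi (Ordinal iN)) (entry_ord pi (Ordinal jN)).
  exact: w_pat.
have w_pat (i j : 'I_N.+1) : pi i < pi j ->
    (iter i (@signed_shift _ sigma) w < iter j (@signed_shift _ sigma) w)%O.
  move=> lt; apply: w_lt; rewrite ?leq_ord //.
  by rewrite !entry_ord.
split=> //=; exists w; apply/PatP; split=> [i j e|i j].
  by case: (ltngtP (pi i) (pi j)) => [/w_pat|/w_pat|/val_inj/perm_inj //];
     rewrite e ltxx.
apply/idP/idP => [/w_pat //|]; apply: contraLR; rewrite -leqNgt -leNgt.
rewrite leq_eqVlt => /predU1P[/val_inj/perm_inj -> //|/w_pat/ltW //].
Qed.
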